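(* Every finite graph $G$ with maximum degree $\Delta(G)=3$ has a semi-coloring. Consequently, every class-1 cubic graph has a tight product with every cubic graph.
   Context: All graphs are finite, undirected, and may have multiple edges and loops. Degrees count multiple edges with multiplicity, and a loop contributes $2$ to the degree of its vertex; the neighbor set $N_G(v)$ is a multiset. For a graph $G=(V,E)$ with maximum degree $\Delta$, a semi-coloring is a coloring of $E$ with color set $[\Delta]\cup\binom{[\Delta]}{2}$ (each edge gets either an element $i\in[\Delta]$, of weight $1$ for $i$, or an unordered pair $\{i,j\}$, regarded as ''half $i$ and half $j$'', contributing weight $1/2$ to each of $i$ and $j$) such that for every vertex $v$: (a) for every $i\in[\Delta]$ the total weight of $i$ on the edges incident with $v$ is at most $1$; (b) for every $i\neq j$ there are either $0$ or $2$ edges colored $\{i,j\}$ incident with $v$. A graph is of class 1 if its edge-chromatic number equals its maximum degree; cubic means $3$-regular. A map $\phi:V(H)\to V(G)$ is a covering map if for every $v\in V(H)$, $\phi$ maps the multiset $N_H(v)$ one-to-one and onto the multiset $N_G(\phi(v))$. A graph $H$ is a tight product of $G_1$ and $G_2$ if $V(H)=V(G_1)\times V(G_2)$ and both coordinate projections are covering maps. *)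

(* Defs.v *)
From HB Require Import structures.
From mathcomp Require Import all_boot all_order all_algebra.

Set Implicit Arguments.
Unset Strict Implicit.
Unset Printing Implicit Defensive.

Import Order.TTheory GRing.Theory Num.Theory.
Local Open Scope ring_scope.

(* Finite undirected multigraphs on V, loops allowed.  The endpoints of an
   edge are indexed by bool only in order to name its two ends; no definition
   below depends on which end is which. *)
Record mgraph (V : finType) := MGraph {
  edge : finType;
  endpoint : edge -> bool -> V
}.

Section Multigraph.
Variables (V : finType) (G : mgraph V).

(* Edges incident with v, as half-edges: a loop at v occurs twice. *)
Definition halfedges (v : V) : {set edge G * bool} :=
  [set h | endpoint h.1 h.2 == v].

Definition degree (v : V) : nat := #|halfedges v|.

Definition max_degree : nat := (\max_(v : V) degree v)%N.

Definition cubic : Prop := forall v : V, degree v = 3%N.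

(* The multiset N_G(v), a sequence to be read up to perm_eq. *)
Definition neighbors (v : V) : seq V :=
  [seq endpoint h.1 (~~ h.2) | h <- enum (halfedges v)].

(* No coloring is proper if G has a loop, since the two halves of the loop
   are distinct elements of halfedges v. *)
Definition proper_edge_coloring (k : nat) (c : edge G -> 'I_k) : Prop :=
  forall v : V, {in halfedges v &, injective (fun h => c h.1)}.

Definition edge_colorable (k : nat) : Prop :=
  exists c : edge G -> 'I_k, proper_edge_coloring c.

Definition is_edge_chromatic_number (k : nat) : Prop :=
  edge_colorable k /\ (forall j : nat, edge_colorable j -> (k <= j)%N).

Definition class1 : Prop := is_edge_chromatic_number max_degree.

End Multigraph.

(* [D] together with the 2-element subsets of [D]; [D] is 'I_D. *)
Definition semi_color (D : nat) : Type :=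
  ('I_D + {A : {set 'I_D} | #|A| == 2%N})%type.

Definition color_weight (D : nat) (i : 'I_D) (x : semi_color D) : rat :=
  match x with
  | inl j => if i == j then 1 else 0
  | inr A => if i \in val A then 1 / 2 else 0
  end.

Definition is_mixed (D : nat) (i j : 'I_D) (x : semi_color D) : bool :=
  match x with
  | inl _ => false
  | inr A => val A == [set i; j]
  end.

Definition semi_coloring (V : finType) (G : mgraph V)
    (c : edge G -> semi_color (max_degree G)) : Prop :=
  forall v : V,
    (forall i : 'I_(max_degree G),
       \sum_(h in halfedges G v) color_weight i (c h.1) <= 1) /\
    (forall i j : 'I_(max_degree G), i != j ->
       #|[set h in halfedges G v | is_mixed i j (c h.1)]| = 0%N \/
       #|[set h in halfedges G v | is_mixed i j (c h.1)]| = 2%N).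

Definition covering_map (V W : finType) (H : mgraph W) (G : mgraph V)
    (phi : W -> V) : Prop :=
  forall v : W, perm_eq (map phi (neighbors H v)) (neighbors G (phi v)).

Definition tight_product (V1 V2 : finType) (G1 : mgraph V1) (G2 : mgraph V2)
    (H : mgraph (V1 * V2)%type) : Prop :=
  covering_map H G1 (fun p : V1 * V2 => p.1) /\
  covering_map H G2 (fun p : V1 * V2 => p.2).

(* Main.v *)
Require Import Defs.
From HB Require Import structures.
From mathcomp Require Import all_boot all_order all_algebra.
From mathcomp Require Import all_fingroup zify.

(** A cubic graph, possibly with dangling half-edges, is semi-coloured by
    induction.  A bridge is cut into two dangling half-edges, and the colours of
    one side are permuted so that both halves agree.  Two dangling half-edges
    are joined to one edge; if that edge is then mixed, its mixed cycle is
    reopened into a path on which the two colours alternate.  What remains is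
    bridgeless with at most one dangling half-edge, and has a perfect matching
    containing that half-edge: the matching gets one colour, its complement the
    pair of the other two.

    The matching comes from the sharpening of Petersen's theorem in which a
    prescribed edge is avoided, by Frink's reduction: for an edge uv, with other
    neighbours a, b of u and c, d of v, delete u and v and add either ac and bd,
    or ad and bc; one of the two graphs is bridgeless.

    For the tight product, orient the mixed cycles of G2, and 2-colour, for each
    pair of colours of G1, the cycles of edges with these colours.  An edge of
    G1 is lifted along the edges of G2 carrying its colour, where the side of
    the bipartition and the orientation decide which of the two mixed edges at a
    vertex takes which of its two colours. *)

Set Implicit Arguments.
Unset Strict Implicit.
Unset Printing Implicit Defensive.

(** * Cuts and reductions of cubic pairings *)

Section CubicPairings.

Variable V : finType.
Implicit Types (W S U P Q X Y : {set V}) (a : V * 'I_3 -> V * 'I_3).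
Implicit Types (x y e f g p q : V * 'I_3) (s : seq (V * 'I_3)).

(* The darts (half-edges) at v are [(v, i)] with [i : 'I_3]; a graph on the
   vertex set W is a map [a] exchanging the two darts of each edge.  Darts of
   vertices outside W carry junk, so that graphs of all sizes share one type.
   The darts in [s] are still to be paired. *)
Definition pairing_off s W a : Prop := forall x, x.1 \in W -> x \notin s ->
  [/\ (a x).1 \in W, a x \notin s & a (a x) = x].

Definition pairing W a : Prop := pairing_off [::] W a.

Definition fixfree W a : Prop := forall x, x.1 \in W -> a x != x.

(** For disjoint [P] and [Q] each edge between them is counted once, by its dart in [P], and a
    dangling dart is never counted. *)
Definition cut a P Q : nat := #|[set x | (x.1 \in P) && ((a x).1 \in Q)]|.

Definition bridgeless W a : bool :=
  [forall S : {set V}, (S \subset W) ==> (cut a S (W :\: S) != 1)].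

(** The former partners of [p] and [q] are left untouched, so this serves where they are no longer
    in the vertex set or are [p] and [q] themselves. With [p = q] it makes [p] dangling. *)
Definition rewire a p q : V * 'I_3 -> V * 'I_3 :=
  fun x => if x == p then q else if x == q then p else a x.

Lemma bridgelessPn W a :
  ~~ bridgeless W a -> exists2 S : {set V}, S \subset W & cut a S (W :\: S) = 1.
Proof.
rewrite negb_forall => /existsP[S]; rewrite negb_imply => /andP[sS].
by rewrite negbK => /eqP; exists S.
Qed.

Lemma pairingP W a x : pairing W a -> x.1 \in W -> (a x).1 \in W /\ a (a x) = x.
Proof. by move=> aW xW; case: (aW x xW isT). Qed.

Lemma pairing_inj W a : pairing W a -> {in [pred x | x.1 \in W] &, injective a}.
Proof.
by move=> aW x y /(pairingP aW)[_ {2}<-] /(pairingP aW)[_ {2}<-] ->.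
Qed.

Lemma darts3 e : exists f g, [/\ f.1 = e.1, g.1 = e.1, uniq [:: e; f; g] &
  forall x, x.1 = e.1 -> x \in [:: e; f; g]].
Proof.
case: e => u i.
have [j [l [ij il jl H]]] : exists j l : 'I_3,
    [/\ i != j, i != l, j != l & forall k, k \in [:: i; j; l]].
  by case: i => [[|[|[|//]]] hi];
    [exists (@Ordinal 3 1 isT), (@Ordinal 3 2 isT)
    |exists (@Ordinal 3 0 isT), (@Ordinal 3 2 isT)
    |exists (@Ordinal 3 0 isT), (@Ordinal 3 1 isT)];
    split=> // -[[|[|[|//]]] hk].
exists (u, j), (u, l); split=> //=.
  by rewrite !inE !xpair_eqE eqxx /= negb_or ij il jl.
by case=> w k /= ->; have := H k; rewrite !inE !xpair_eqE eqxx.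
Qed.

Lemma cut_sym W a P Q : pairing W a -> P \subset W -> Q \subset W ->
  cut a P Q = cut a Q P.
Proof.
move=> aW.
have le (A B : {set V}) : A \subset W -> B \subset W -> cut a A B <= cut a B A.
  move=> sA sB; rewrite /cut -(@card_in_imset _ _ a); last first.
    move=> x y; rewrite !inE => /andP[xA _] /andP[yA _].
    by apply: (pairing_inj aW); rewrite inE (subsetP sA).
  apply/subset_leq_card/subsetP => _ /imsetP[x + ->]; rewrite !inE => /andP[xA ->].
  by have [_ ->] := pairingP aW (subsetP sA _ xA).
by move=> sP sQ; apply/eqP; rewrite eqn_leq !le.
Qed.

Lemma cutUr a P Q1 Q2 : [disjoint Q1 & Q2] ->
  cut a P (Q1 :|: Q2) = cut a P Q1 + cut a P Q2.
Proof.
move=> dQ; rewrite /cut -(cardsID [set x | (a x).1 \in Q1]); congr (_ + _).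
  by apply: eq_card => x; rewrite !inE; case: (_ \in Q1); rewrite ?andbF ?andbT.
apply: eq_card => x; rewrite !inE; have := disjointFr dQ (x := (a x).1).
by case: (_ \in Q1) => [-> //|_] /=; rewrite ?andbF.
Qed.

Lemma cutUl a P1 P2 Q : [disjoint P1 & P2] ->
  cut a (P1 :|: P2) Q = cut a P1 Q + cut a P2 Q.
Proof.
move=> dP; rewrite /cut -(cardsID [set x | x.1 \in P1]); congr (_ + _).
  by apply: eq_card => x; rewrite !inE; case: (_ \in P1); rewrite ?andbF ?andbT.
apply: eq_card => x; rewrite !inE; have := disjointFr dP (x := x.1).
by case: (_ \in P1) => [-> //|_] /=; rewrite ?andbF.
Qed.

Lemma cut_count a P Q s : uniq s ->
  (forall x, x.1 \in P -> ((a x).1 \in Q) = (x \in s)) ->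
  cut a P Q = count [pred x | x.1 \in P] s.
Proof.
move=> us H; rewrite -size_filter -(card_uniqP (filter_uniq _ us)).
apply: eq_card => x; rewrite inE mem_filter /=.
by case xP: (x.1 \in P) => //=; rewrite H.
Qed.

(** The partners that [p] and [q] lose lie outside [Q], so losing them costs nothing and only the
    new edge enters the count. *)
Lemma cut_rewire a p q P Q : p != q -> (a p).1 \notin Q -> (a q).1 \notin Q ->
  cut (rewire a p q) P Q = cut a P Q + ((p.1 \in P) && (q.1 \in Q))
                                     + ((q.1 \in P) && (p.1 \in Q)).
Proof.
have E b : cut b P Q = \sum_x ((x.1 \in P) && ((b x).1 \in Q)).
  by rewrite /cut -sum1_card big_mkcond; apply: eq_bigr => x _; rewrite inE; case: ifP.
move=> npq /negbTE pQ /negbTE qQ; rewrite !E.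
rewrite (bigD1 p) //= (bigD1 q) ?(eq_sym q) //=.
rewrite [in RHS](bigD1 p) //= [in RHS](bigD1 q) ?(eq_sym q) //= pQ qQ !andbF.
rewrite /rewire !eqxx (eq_sym q) (negbTE npq).
under eq_bigr => x /andP[/negbTE-> /negbTE->] do [].
lia.
Qed.

Lemma pairing_off_rewire s W a p q : pairing_off [:: p, q & s] W a ->
  p.1 \in W -> q.1 \in W -> p \notin s -> q \notin s ->
  pairing_off s W (rewire a p q).
Proof.
move=> aW pW qW ps qs x xW xs; rewrite /rewire.
case: (eqVneq x p) => [->|xp]; first by rewrite eqxx; split=> //; case: eqP => [->|].
case: (eqVneq x q) => [->|xq]; first by rewrite eqxx; split.
have /(aW x xW) : x \notin [:: p, q & s] by rewrite !inE !negb_or xp xq.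
by case; rewrite !inE !negb_or => -> /and3P[/negbTE-> /negbTE-> ->] ->.
Qed.

Lemma pairing_setD W a U s : pairing W a ->
  (forall x, x.1 \in W :\: U -> ((a x).1 \in U) = (x \in s)) ->
  pairing_off s (W :\: U) a.
Proof.
move=> aW sU x xWU xs; have := xWU; rewrite inE => /andP[xU xW].
have [axW aax] := pairingP aW xW.
have axWU : (a x).1 \in W :\: U by rewrite inE sU // xs.
by split=> //; rewrite -sU // aax.
Qed.

(** * Deleting a vertex set from a bridgeless pairing *)

Section Reduction.

Variables (W U : {set V}) (a : V * 'I_3 -> V * 'I_3) (s : seq (V * 'I_3)).
Hypotheses (aW : pairing W a) (sUW : U \subset W) (us : uniq s).
Hypothesis sU : forall x, x.1 \in W :\: U -> ((a x).1 \in U) = (x \in s).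
Hypothesis noB : bridgeless W a.

(** In the whole graph [S] has further edges, those to [U], and these belong exactly to the darts of
    [s] in [S]. *)
Lemma cut_reduced S : S \subset W :\: U ->
  cut a S ((W :\: U) :\: S) + count [pred x | x.1 \in S] s != 1.
Proof.
move=> sS; have sSW := subset_trans sS (subsetDl _ _).
have := implyP (forallP noB S) sSW.
rewrite -(@cut_count a S U) //; last by move=> x xS; apply/sU/(subsetP sS).
rewrite -cutUr; last first.
  rewrite -setI_eq0; apply/eqP/setP => v; rewrite !inE.
  by case: (v \in U); rewrite ?andbF.
congr (cut _ _ _ != _); apply/setP => v; rewrite !inE.
case vS: (v \in S) => /=; first by move/(subsetP sS): vS; rewrite inE => /andP[/negbTE].
by case vU: (v \in U); rewrite ?orbF // (subsetP sUW).
Qed.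

Lemma cut_reduced_compl S : S \subset W :\: U ->
  cut a S ((W :\: U) :\: S) = cut a ((W :\: U) :\: S) S.
Proof.
move=> sS; apply: (cut_sym aW); first exact: subset_trans sS (subsetDl _ _).
exact: subset_trans (subsetDl _ _) (subsetDl _ _).
Qed.

Lemma setDDK S : S \subset W :\: U -> (W :\: U) :\: ((W :\: U) :\: S) = S.
Proof. by move=> sS; rewrite setDDr setDv set0U; apply/setIidPr. Qed.

Lemma cut_reducedC S : S \subset W :\: U ->
  cut a S ((W :\: U) :\: S) + count [pred x | x.1 \in (W :\: U) :\: S] s != 1.
Proof.
by move=> sS; have := cut_reduced (subsetDl (W :\: U) S); rewrite setDDK // -cut_reduced_compl.
Qed.

End Reduction.

Lemma bridgeless_drop W U a : pairing W a -> U \subset W ->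
  (forall x, x.1 \in W :\: U -> (a x).1 \notin U) ->
  bridgeless W a -> pairing (W :\: U) a /\ bridgeless (W :\: U) a.
Proof.
move=> aW sUW nU noB.
have sU x : x.1 \in W :\: U -> ((a x).1 \in U) = (x \in [::]) by move/nU/negbTE.
split; first exact: (pairing_setD aW sU).
apply/forallP => S; apply/implyP => sS.
by have := cut_reduced (s := [::]) sUW isT sU noB sS; rewrite /= addn0.
Qed.

(** Let [S] be a one-edge cut after splicing. If the new edge crosses it, no old edge does, and [S]
    was a one-edge cut already. Otherwise [S] or its complement contains neither [p] nor [q], and
    that side was one. *)
Lemma bridgeless_splice W U a p q : pairing W a -> U \subset W -> p != q ->
  p.1 \in W :\: U -> q.1 \in W :\: U ->
  (forall x, x.1 \in W :\: U -> ((a x).1 \in U) = (x \in [:: p; q])) ->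
  bridgeless W a ->
  pairing (W :\: U) (rewire a p q) /\ bridgeless (W :\: U) (rewire a p q).
Proof.
move=> aW sUW npq pW qW sU noB.
have us : uniq [:: p; q] by rewrite /= inE npq.
split; first exact: (pairing_off_rewire (pairing_setD aW sU)).
apply/forallP => S; apply/implyP => sS.
have nQ z : z.1 \in W :\: U -> z \in [:: p; q] -> (a z).1 \notin (W :\: U) :\: S.
  by move=> zW zs; rewrite !in_setD sU // zs /= andbF.
have [np nq] : (a p).1 \notin (W :\: U) :\: S /\ (a q).1 \notin (W :\: U) :\: S.
  by split; apply: nQ => //; rewrite !inE eqxx ?orbT.
have := cut_reducedC aW sUW us sU noB sS; have := cut_reduced sUW us sU noB sS.
rewrite cut_rewire //= !in_setD; move: pW qW; rewrite !in_setD => -> ->.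
rewrite !andbT.
by case: (p.1 \in S); case: (q.1 \in S) => /=; lia.
Qed.

(** Here [n] counts the old edges leaving a set, and the booleans tell which of the four darts lie
    in it. If a new edge crossed, the side without the other new edge would be a one-edge cut of the
    given graph. If both new edges lay on one side, the opposite side would be. *)
Lemma frink_cut (bp bq bp' bq' : bool) n :
  n + (bp && ~~ bq) + (bq && ~~ bp) + (bp' && ~~ bq') + (bq' && ~~ bp') = 1 ->
  n + (bp + (bq + (bp' + (bq' + 0)))) != 1 ->
  n + (~~ bp + (~~ bq + (~~ bp' + (~~ bq' + 0)))) != 1 ->
  [/\ bq = bp, bq' = bp', bp' = ~~ bp & n = 1].
Proof. by case: bp; case: bq; case: bp'; case: bq' => //=; split; lia. Qed.

(** A diagonal edge, counted by [bc] or [ae], accounts for both cuts and meets only two quadrants.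
    Otherwise the two cuts use one edge each, and these share a quadrant, so that they meet only
    three. *)
Lemma frink_quadrants ab ac ae bc be ce :
  ac + bc + (ae + be) = 1 -> ab + bc + (ae + ce) = 1 ->
  ab + (ac + ae) + 1 != 1 -> ab + (bc + be) + 1 != 1 ->
  ac + (bc + ce) + 1 != 1 -> ae + (be + ce) + 1 != 1 -> False.
Proof. lia. Qed.

(* If X and Y are one-edge cuts of the two rewirings, then each of the four sets
   they generate contains one of p, q, p', q', and the two cut edges cannot meet
   all four, so that one of the four is a one-edge cut of the given graph. *)
Lemma bridgeless_frink W U a p q p' q' : pairing W a -> U \subset W ->
  uniq [:: p; q; p'; q'] -> (forall x, x \in [:: p; q; p'; q'] -> x.1 \in W :\: U) ->
  (forall x, x.1 \in W :\: U -> ((a x).1 \in U) = (x \in [:: p; q; p'; q'])) ->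
  bridgeless W a ->
  bridgeless (W :\: U) (rewire (rewire a p q) p' q') ||
  bridgeless (W :\: U) (rewire (rewire a p q') p' q).
Proof.
move=> aW sUW us sW sU noB; apply/norP.
case=> /bridgelessPn[X sX cX] /bridgelessPn[Y sY cY].
have := us.
rewrite /= !inE !negb_or -!andbA => /and4P[pq pp' pq' /and4P[qp' qq' p'q' _]].
have nQ z (S : {set V}) : z \in [:: p; q; p'; q'] -> (a z).1 \notin (W :\: U) :\: S.
  by move=> zs; have := sU _ (sW _ zs); rewrite zs !inE => ->; rewrite andbF.
have [pW qW pW' qW'] : [/\ p.1 \in W :\: U, q.1 \in W :\: U, p'.1 \in W :\: U
   & q'.1 \in W :\: U] by split; apply: sW; rewrite !inE eqxx ?orbT.
have [np nq np' nq'] : [/\ forall S : {set V}, (a p).1 \notin (W :\: U) :\: S,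
    forall S : {set V}, (a q).1 \notin (W :\: U) :\: S,
    forall S : {set V}, (a p').1 \notin (W :\: U) :\: S &
    forall S : {set V}, (a q').1 \notin (W :\: U) :\: S].
  by split=> S; apply: nQ; rewrite !inE eqxx ?orbT.
have r1 z (b : V * 'I_3) c : z != b -> z != c -> rewire a b c z = a z.
  by rewrite /rewire => /negbTE-> /negbTE->.
move: cX; rewrite cut_rewire // ?r1 //; try by rewrite eq_sym.
rewrite cut_rewire // => cX.
move: cY; rewrite cut_rewire // ?r1 //; try by rewrite eq_sym.
rewrite cut_rewire // => cY.
pose N S := cut_reduced sUW us sU noB (S := S).
pose NC S := cut_reducedC aW sUW us sU noB (S := S).
have bit (z : V * 'I_3) (S : {set V}) : z.1 \in W :\: U -> (z.1 \in (W :\: U) :\: S) = (z.1 \notin S).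
  by move=> zW; rewrite in_setD zW andbT.
move: cX cY; rewrite !bit // => cX cY.
have := NC _ sY; have := NC _ sX; rewrite /= !bit // => NX NY.
have [eX1 eX2 eX3 fX] := frink_cut cX (N _ sX) NX.
(* The second rewiring joins [p] to [q'] and [p'] to [q], so the terms of [q] and [q'] change places
   before [frink_cut] applies. *)
have sw (b2 b3 b4 : bool) : b2 + (b3 + (b4 + 0)) = b4 + (b3 + (b2 + 0)).
  by case: b2; case: b3; case: b4.
have := N _ sY; rewrite /= sw => NY'; rewrite sw in NY.
have [eY1 eY2 eY3 fY] := frink_cut cY NY' NY.
clear cX cY.
set T := W :\: U in sX sY N fX fY pW qW pW' qW' *.
pose A := X :&: Y; pose B := X :\: Y; pose C := Y :\: X; pose E := T :\: (X :|: Y).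
have sub (S : {set V}) : S \subset T -> S \subset W by move/subset_trans; apply; apply: subsetDl.
have XT v : (v \in X) ==> (v \in T) by apply/implyP/subsetP.
have YT v : (v \in Y) ==> (v \in T) by apply/implyP/subsetP.
have [sA sB sC sE] : [/\ A \subset T, B \subset T, C \subset T & E \subset T].
  split; rewrite ?subsetDl //; first exact: subset_trans (subsetIl _ _) sX.
    exact: subset_trans (subsetDl _ _) sX.
  exact: subset_trans (subsetDl _ _) sY.
have dis (S1 S2 : {set V}) : S1 :&: S2 = set0 -> [disjoint S1 & S2].
  by rewrite -setI_eq0 => ->.
have [[dAB dAC dAE] [dBC dBE dCE]] :
    [/\ [disjoint A & B], [disjoint A & C] & [disjoint A & E]] /\
    [/\ [disjoint B & C], [disjoint B & E] & [disjoint C & E]].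
  by do 2!split; apply/dis/setP => v; rewrite /A /B /C /E !(in_setD, in_setU, in_setI) in_set0;
    case: (v \in X); case: (v \in Y); rewrite ?andbF.
have [[EX EXc] [EY EYc]] : (X = A :|: B /\ T :\: X = C :|: E) /\
    (Y = A :|: C /\ T :\: Y = B :|: E).
  by do 2!split; apply/setP => v; rewrite /A /B /C /E !(in_setD, in_setU, in_setI);
    have := XT v; have := YT v; rewrite in_setD;
    case: (v \in X); case: (v \in Y); case: (v \in U); case: (v \in W).
have [[EA EB] [EC EE]] : (T :\: A = B :|: (C :|: E) /\ T :\: B = A :|: (C :|: E)) /\
    (T :\: C = A :|: (B :|: E) /\ T :\: E = A :|: (B :|: C)).
  by do 2!split; apply/setP => v; rewrite /A /B /C /E !(in_setD, in_setU, in_setI);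
    have := XT v; have := YT v; rewrite in_setD;
    case: (v \in X); case: (v \in Y); case: (v \in U); case: (v \in W).
have dU (S1 S2 S3 : {set V}) : [disjoint S1 & S2] -> [disjoint S1 & S3] ->
    [disjoint S1 & S2 :|: S3].
  by rewrite -!setI_eq0 setIUr => /eqP-> /eqP->; rewrite setU0.
have sy S1 S2 : S1 \subset T -> S2 \subset T -> cut a S1 S2 = cut a S2 S1.
  by move=> s1 s2; apply: (cut_sym aW); apply: sub.
have := (N _ sA, N _ sB, N _ sC, N _ sE).
rewrite EA EB EC EE !cutUr ?dU //.
rewrite (sy B A) // (sy C A) // (sy C B) // (sy E A) // (sy E B) // (sy E C) //.
move: fX fY; rewrite EXc EYc {1}EX {1}EY !cutUr // !cutUl // (sy C B) //.
(* The dart [p] agrees with [q] on [X] and with [q'] on [Y], and differs from [p'] on both; hence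
   each quadrant contains exactly one of the four. *)
have zE (z : V * 'I_3) : z.1 \in T -> (z.1 \in E) = (z.1 \notin X) && (z.1 \notin Y).
  by move=> zT; rewrite in_setD zT andbT in_setU negb_or.
rewrite /= !zE // /A /B /C !(in_setD, in_setI) eX1 eX2 eX3 eY1 eY2 eY3.
by case: (p.1 \in X); case: (p.1 \in Y) => fX fY [[[nA nB] nC] nE];
  apply: frink_quadrants fX fY nA nB nC nE.
Qed.

End CubicPairings.

(** * Petersen's theorem avoiding an edge *)

Section Matchings.

Variable V : finType.
Implicit Types (W S U P Q X Y : {set V}) (a : V * 'I_3 -> V * 'I_3).
Implicit Types (x y e f g p q : V * 'I_3) (s : seq (V * 'I_3)) (m : V -> 'I_3).

Lemma darts3_all x y z : y.1 = x.1 -> z.1 = x.1 -> uniq [:: x; y; z] ->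
  forall w : V * 'I_3, w.1 = x.1 -> w \in [:: x; y; z].
Proof.
move=> yx zx us w wx; have [f [g [fx gx _ H]]] := darts3 x.
have sub : {subset [:: x; y; z] <= [:: x; f; g]}.
  by move=> v vs; apply: H; move: vs; rewrite !inE => /or3P[] /eqP->.
by have [_ ->] := uniq_min_size us sub isT; apply: H.
Qed.

Lemma darts2 x y : y.1 = x.1 -> x != y ->
  exists t : V * 'I_3, t.1 = x.1 /\ uniq [:: x; y; t].
Proof.
move=> yx xy; have [f [g [fx gx us H]]] := darts3 x.
have := H y yx; rewrite !inE eq_sym (negbTE xy) /= => /orP[] /eqP->; [exists g|exists f] => //.
by split=> //; move: us; rewrite /= !inE !negb_or (eq_sym g) => /and3P[/andP[-> ->] ->].
Qed.

(** A perfect matching is given by the index of the matched dart at each vertex; a dangling dart may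
    be matched with itself. *)
Definition matching W a m : Prop :=
  forall w, w \in W -> m (a (w, m w)).1 = (a (w, m w)).2.

Lemma matchingE W a m x : pairing W a -> matching W a m -> x.1 \in W ->
  (m (a x).1 == (a x).2) = (m x.1 == x.2).
Proof.
move=> aW mW xW.
have half y : y.1 \in W -> m y.1 == y.2 -> m (a y).1 == (a y).2.
  by case: y => w i /= wW /eqP <-; rewrite mW.
have [axW aax] := pairingP aW xW.
by apply/idP/idP => [/(half _ axW)|/(half _ xW) //]; rewrite aax.
Qed.

(** Only the darts in [s] and those at [U] see the difference between [a] and [a']; all others
    inherit the condition from [m']. *)
Lemma matching_glue W U a a' s m m' : pairing (W :\: U) a' ->
  matching (W :\: U) a' m' -> {in W :\: U, m =1 m'} ->
  (forall x, x.1 \in W :\: U -> x \notin s -> a' x = a x) ->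
  (forall x, x.1 \in W :\: U -> x \in s -> m' x.1 = x.2 -> m (a x).1 = (a x).2) ->
  {in U, forall w, m (a (w, m w)).1 = (a (w, m w)).2} ->
  matching W a m.
Proof.
move=> aW' mW' mm' a'E ms mU w wW; have [/mU //|wU] := boolP (w \in U).
have wWU : w \in W :\: U by rewrite in_setD wU.
rewrite (mm' w wWU); have [xs|xs] := boolP ((w, m' w) \in s); first exact: (ms (w, m' w)).
rewrite -a'E // mm'; first exact: mW'.
by have [] := pairingP aW' (x := (w, m' w)) wWU.
Qed.

(** A loop takes two of the three darts at its vertex, and the edge of the third would be a
    bridge. *)
Lemma loopless W a x : pairing W a -> fixfree W a -> bridgeless W a ->
  x.1 \in W -> (a x).1 != x.1.
Proof.
move=> aW aF noB xW; apply/negP => /eqP ax.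
have [f [g [fx gx us H]]] := darts3 x.
wlog axf : f g fx gx us H / a x = f.
  move=> wl; have := H _ ax; rewrite !inE (negbTE (aF _ xW)) /= => /orP[] /eqP axf.
    exact: (wl f g).
  apply: (wl g f) => //; first by move: us; rewrite /= !inE !negb_or (eq_sym g) => /and3P[/andP[-> ->] ->].
  by move=> y /H; rewrite !inE (orbC (y == f)).
move: us; rewrite /= !inE negb_or !andbT => /andP[/andP[xf xg] fg].
have aax : a f = x by rewrite -axf; case: (pairingP aW xW).
have gW : g.1 \in W by rewrite gx.
have agx : (a g).1 != x.1.
  have [_ aag] := pairingP aW gW.
  apply/negP => /eqP /H; rewrite !inE (negbTE (aF _ gW)) orbF.
  case/orP => /eqP ag; move: aag; rewrite ag ?axf ?aax => E.
    by rewrite E eqxx in fg.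
  by rewrite E eqxx in xg.
have := implyP (forallP noB [set x.1]); rewrite sub1set => /(_ xW)/eqP; apply.
rewrite (@cut_count _ _ _ _ [:: g]) //= ?inE ?gx ?eqxx //.
move=> y; rewrite inE => /eqP yx; have := H _ yx; rewrite !inE.
case/or3P => /eqP->.
- by rewrite axf fx eqxx (negbTE xg).
- by rewrite aax eqxx (negbTE fg).
- by rewrite agx eqxx; case: (pairingP aW gW).
Qed.

Lemma rewire_off a p q x : x \notin [:: p; q] -> rewire a p q x = a x.
Proof. by rewrite /rewire !inE negb_or => /andP[/negbTE-> /negbTE->]. Qed.

Lemma rewirel a p q : rewire a p q p = q.
Proof. by rewrite /rewire eqxx. Qed.

Lemma rewirer a p q : rewire a p q q = p.
Proof. by rewrite /rewire eqxx; case: eqP. Qed.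

Lemma fixfree_rewire W a p q :
  p != q -> (forall x, x.1 \in W -> x \notin [:: p; q] -> a x != x) ->
  fixfree W (rewire a p q).
Proof.
move=> pq aF x xW; have [|xs] := boolP (x \in [:: p; q]); last first.
  by rewrite rewire_off ?aF.
by rewrite !inE => /orP[]/eqP->; rewrite ?rewirel ?rewirer // eq_sym.
Qed.

Definition set_match m u i v j : V -> 'I_3 :=
  fun w => if w == u then i else if w == v then j else m w.

Lemma set_match_off m u i v j W : {in W :\: [set u; v], set_match m u i v j =1 m}.
Proof.
move=> w; rewrite /set_match !inE negb_or => /andP[/andP[/negbTE-> /negbTE->] _].
by [].
Qed.

(** Since [m'] avoids the new edge [pq], the edges of [e] and [s] stay unmatched. If [m'] uses the
    new edge [p'q'], the edges of [g] and [t] replace it; otherwise the edge from [f] to [h] is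
    added. *)
Lemma matching_frink W a e f g (h s t : V * 'I_3) (p := a e) (p' := a g) (q := a s) (q' := a t)
    (W' := W :\: [set e.1; h.1]) (a' := rewire (rewire a p q) p' q') m' :
  pairing W a -> pairing W' a' -> uniq [:: p; q; p'; q'] ->
  f.1 = e.1 -> g.1 = e.1 -> t.1 = h.1 -> e.1 != h.1 ->
  e.1 \in W -> h.1 \in W ->
  a f = h -> e.2 != f.2 -> e.2 != g.2 ->
  (forall x, x \in [:: p; q; p'; q'] -> x.1 \in W') ->
  matching W' a' m' -> m' p.1 != p.2 ->
  exists m, matching W a m /\ m e.1 != e.2.
Proof.
move=> aW aW' us fe ge th eh eW hW af ef eg sW mW mp.
have [[pW qW] [pW' qW']] : (p.1 \in W' /\ q.1 \in W') /\ (p'.1 \in W' /\ q'.1 \in W').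
  by do 2!split; apply: sW; rewrite !inE eqxx ?orbT.
have ah : a h = f by rewrite -af; case: (pairingP aW (x := f)); rewrite ?fe.
have inv x : x.1 \in W -> a (a x) = x by case/(pairingP aW).
have aq' : a' p' = q' by rewrite /a' rewirel.
have aq : a' p = q.
  rewrite /a' rewire_off ?rewirel //; move: us; rewrite /= !inE !negb_or.
  by case/and3P => /and3P[_ -> ->].
have mq : m' q.1 != q.2 by rewrite -aq (matchingE aW').
have mq' : (m' q'.1 == q'.2) = (m' p'.1 == p'.2) by rewrite -aq' (matchingE aW').
pose b := m' p'.1 == p'.2.
pose m := set_match m' e.1 (if b then g.2 else f.2) h.1 (if b then t.2 else h.2).
have off : {in W', m =1 m'} by exact: set_match_off.
have me : m e.1 = if b then g.2 else f.2 by rewrite /m /set_match eqxx.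
have mh : m h.1 = if b then t.2 else h.2.
  by rewrite /m /set_match eq_sym (negbTE eh) eqxx.
exists m; split; last by rewrite me; case: (b); rewrite eq_sym.
apply: (matching_glue (m := m) aW' mW off (s := [:: p; q; p'; q'])).
- move=> x _ xs; rewrite /a' !rewire_off //; move: xs; rewrite !inE !negb_or.
    by case/and4P => -> ->.
  by case/and4P => _ _ -> ->.
- move=> x _; rewrite !inE => /or4P[] /eqP-> mx.
  + by rewrite mx eqxx in mp.
  + by rewrite mx eqxx in mq.
  + by rewrite inv ?ge // me /b mx eqxx.
  + by rewrite inv ?th // mh /b -mq' mx eqxx.
- move=> w; rewrite !inE => /orP[] /eqP->; rewrite ?me ?mh; case: ifP => bE.
  + by rewrite -ge -surjective_pairing off //; apply/eqP.
  + by rewrite -fe -surjective_pairing af mh bE.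
  + by rewrite -th -surjective_pairing off //; apply/eqP; rewrite mq'.
  + by rewrite -surjective_pairing ah fe me bE.
Qed.

(** The avoided edge carries the induction on the number of vertices: where a new edge through [a e]
    is made, the smaller matching is chosen to avoid it, and so extends over the two deleted
    vertices without using [e]. *)
Lemma petersen W a e : pairing W a -> fixfree W a -> bridgeless W a ->
  exists m, matching W a m /\ (e.1 \in W -> m e.1 != e.2).
Proof.
have [n] := ubnP #|W|; elim: n => // n IH in W a e *; rewrite ltnS => Wn aW aF noB.
wlog eW : e / e.1 \in W.
  move=> wl; have [eW|eW] := boolP (e.1 \in W).
    have [m [mW me]] := wl e eW; exists m; split=> // _; exact: me.
  have [W0|[w wW]] := set_0Vmem W.
    by exists (fun=> ord0); split=> // w; rewrite W0 inE.
  by have [m [mW _]] := wl (w, ord0) wW; exists m.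
have inv x : x.1 \in W -> a (a x) = x by case/(pairingP aW).
have clo x : x.1 \in W -> (a x).1 \in W by case/(pairingP aW).
have lp x : x.1 \in W -> (a x).1 != x.1 by apply: loopless.
have neq2 x y : x.1 = y.1 -> x != y -> x.2 != y.2.
  by case: x y => [? ?] [? ?] /= ->; rewrite xpair_eqE eqxx.
have small u v : u \in W -> #|W :\: [set u; v]| < n.
  move=> uW; apply: leq_trans Wn; apply: proper_card; apply/properP.
  by rewrite subsetDl; split=> //; exists u; rewrite // !inE eqxx.
have sub u v : u \in W -> v \in W -> [set u; v] \subset W.
  by move=> uW vW; rewrite subUset !sub1set uW.
have injW x y : x.1 \in W -> y.1 \in W -> a x = a y -> x = y.
  by move=> xW yW; apply: (pairing_inj aW).
(* The case where the edge of [f'] has no parallel edge: its ends then have four other edges, whose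
   far darts survive the deletion. *)
have frink f' g' : f'.1 = e.1 -> g'.1 = e.1 -> uniq [:: e; f'; g'] ->
    (a f').1 != (a g').1 -> (a f').1 != (a e).1 ->
    exists m, matching W a m /\ (e.1 \in W -> m e.1 != e.2).
  move=> fe ge us fg afe; pose h := a f'.
  have H := darts3_all fe ge us.
  have [fW gW] : f'.1 \in W /\ g'.1 \in W by rewrite fe ge.
  have hW : h.1 \in W by apply: clo.
  have eh : e.1 != h.1 by rewrite -fe eq_sym lp.
  have [s [t [sh th uh Hh]]] := darts3 h.
  have [sW tW] : s.1 \in W /\ t.1 \in W by rewrite sh th.
  have := uh; rewrite /= !inE negb_or !andbT => /andP[/andP[hs ht] st].
  have := us; rewrite /= !inE negb_or !andbT => /andP[/andP[ef eg] _].
  pose U := [set e.1; h.1].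
  have inW' x : ((a x).1 \in W :\: U) = [&& (a x).1 != e.1, (a x).1 != h.1 & (a x).1 \in W].
    by rewrite !inE negb_or andbA.
  have away k : k.1 = h.1 -> k != h -> (a k).1 != e.1.
    move=> kh nkh; have kW : k.1 \in W by rewrite kh.
    apply/negP => /eqP /H; rewrite !inE => /or3P[] /eqP akE.
    - by move: afe; rewrite -akE inv // kh eqxx.
    - by move: nkh; rewrite /h -akE inv // eqxx.
    - by move: fg; rewrite -akE inv // kh eqxx.
  have uniq4 (k l : V * 'I_3) : k.1 = h.1 -> l.1 = h.1 -> k != l ->
      uniq [:: a e; a k; a g'; a l].
    move=> kh lh kl; have ne x y : x.1 = e.1 -> y.1 = h.1 -> x != y.
      by move=> xe yh; apply: contra eh => /eqP xy; rewrite -xe -yh xy.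
    rewrite (@map_inj_in_uniq _ _ a [:: e; k; g'; l]) /=.
      by rewrite !inE !negb_or kl eg (eq_sym k) (ne e k) ?(ne e l) ?(ne g' l) ?(ne g' k).
    by move=> x y; rewrite !inE => /or4P[] /eqP-> /or4P[] /eqP->; apply: injW;
      rewrite ?kh ?lh ?ge.
  have mem4 (k l : V * 'I_3) : k.1 = h.1 -> l.1 = h.1 -> k != h -> l != h ->
      forall x, x \in [:: a e; a k; a g'; a l] -> x.1 \in W :\: U.
    move=> kh lh nk nl x xs.
    have : [|| x == a e, x == a k, x == a g' | x == a l] by move: xs; rewrite !inE.
    case/or4P => /eqP->; rewrite inW'.
    - by rewrite lp // eq_sym afe clo.
    - by rewrite away // -kh lp ?kh // clo ?kh.
    - by rewrite -ge lp // eq_sym fg clo.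
    - by rewrite away // -lh lp ?lh // clo ?lh.
  (* The darts [k] and [l] are [s] and [t] in the order in which the chosen rewiring links them with
     [e] and [g']. *)
  have fin (k l : V * 'I_3) : k.1 = h.1 -> l.1 = h.1 -> k != h -> l != h -> k != l ->
      (forall x, x.1 \in W :\: U ->
        ((a x).1 \in U) = (x \in [:: a e; a k; a g'; a l])) ->
      bridgeless (W :\: U) (rewire (rewire a (a e) (a k)) (a g') (a l)) ->
      exists m, matching W a m /\ (e.1 \in W -> m e.1 != e.2).
    move=> kh lh nk nl kl sU noB'; have u4 := uniq4 k l kh lh kl.
    have s4 := mem4 k l kh lh nk nl.
    have [[pW qW] [pW' qW']] : ((a e).1 \in W :\: U /\ (a k).1 \in W :\: U) /\
        ((a g').1 \in W :\: U /\ (a l).1 \in W :\: U).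
      by do 2!split; apply: s4; rewrite !inE eqxx ?orbT.
    have := u4; rewrite /= !inE !negb_or !andbT.
    case/and3P => /and3P[pq pp' pq'] /andP[qp' qq'] p'q'.
    have aW' : pairing (W :\: U) (rewire (rewire a (a e) (a k)) (a g') (a l)).
      apply: pairing_off_rewire => //.
      apply: (pairing_off_rewire (pairing_setD aW sU)) => //.
        by rewrite !inE negb_or pp'.
      by rewrite !inE negb_or qp'.
    have [|m' [mW mp]] := IH _ _ (a e) (small _ _ eW) aW' _ noB'.
      apply: fixfree_rewire => // x xW _; apply: fixfree_rewire xW => // y.
      by rewrite in_setD => /andP[_ /aF].
    have [m [mM me]] := matching_frink aW aW' u4 fe ge lh eh eW hW
      (erefl h) (neq2 _ _ (esym fe) ef) (neq2 _ _ (esym ge) eg) s4 mW (mp pW).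
    by exists m.
  have sU x : x.1 \in W :\: U -> ((a x).1 \in U) = (x \in [:: a e; a s; a g'; a t]).
    rewrite 2!inE negb_or in_set1 in_set1 -andbA => /and3P[xe xh xW].
    apply/idP/idP; rewrite !inE => /orP[].
    - move=> /eqP/H; rewrite !inE => /or3P[] /eqP ax; move: xe xh;
        rewrite -(inv x xW) ax ?eqxx ?orbT //.
    - move=> /eqP/Hh; rewrite !inE => /or3P[] /eqP ax; move: xe xh;
        rewrite -(inv x xW) ax ?eqxx ?orbT //.
      by rewrite inv // fe eqxx.
    - by move/eqP->; rewrite inv // eqxx.
    - by case/or3P => /eqP->; rewrite inv // ?sh ?th ?ge eqxx ?orbT.
  have nsh : s != h by rewrite eq_sym.
  have nth' : t != h by rewrite eq_sym.
  have := bridgeless_frink aW (sub _ _ eW hW) (uniq4 s t sh th st)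
    (mem4 s t sh th nsh nth') sU noB.
  case/orP => noB'; first exact: (fin s t).
  apply: (fin t s) => //; first by rewrite eq_sym.
  by move=> x /sU ->; rewrite !inE; case: (x == a s); case: (x == a t);
    rewrite ?orbT.
have [f [g [fe ge us H]]] := darts3 e.
have fW : f.1 \in W by rewrite fe.
have gW : g.1 \in W by rewrite ge.
have := us; rewrite /= !inE negb_or !andbT => /andP[/andP[ef eg] fg].
have eu : (a f).1 != e.1 by rewrite -fe lp.
(* For parallel edges the edge of [f] itself is matched, which works when the smaller matching uses
   none of the rewired darts. *)
have glue2 m' s (a' : V * 'I_3 -> V * 'I_3) (W' := W :\: [set e.1; (a f).1]) :
    pairing W' a' -> matching W' a' m' -> (forall x, x \in s -> m' x.1 != x.2) ->
    (forall x, x \notin s -> a' x = a x) ->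
    exists m, matching W a m /\ (e.1 \in W -> m e.1 != e.2).
  move=> aW' mW ms a'E; pose m := set_match m' e.1 f.2 (a f).1 (a f).2.
  have me : m e.1 = f.2 by rewrite /m /set_match eqxx.
  have mf : m (a f).1 = (a f).2 by rewrite /m /set_match (negbTE eu) eqxx.
  exists m; split=> [|_]; last by rewrite me eq_sym neq2.
  apply: (matching_glue (m := m) (s := s) aW' mW).
  - exact: set_match_off.
  - by move=> x _; apply: a'E.
  - by move=> x _ /ms /eqP.
  - move=> w; rewrite !inE => /orP[]/eqP->; first by rewrite me -fe -surjective_pairing.
    by rewrite mf -surjective_pairing inv // fe me.
have avu : (a f).1 \in W by apply: clo.
(* If [f] and [g] are parallel, either [e] is parallel to them too and the two vertices split off as
   a component, or the one remaining edge at each of the two vertices is spliced with the other into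
   an edge to be avoided. *)
have [/eqP afg|afg] := boolP ((a f).1 == (a g).1).
  have nafg : a f != a g by apply: contra fg => /eqP /injW->.
  have [/eqP afe|afe] := boolP ((a f).1 == (a e).1).
    have uv : uniq [:: a f; a g; a e].
      rewrite /= !inE negb_or !andbT nafg /=.
      by apply/andP; split; [apply: contra ef|apply: contra eg] => /eqP /injW->.
    have [aW' noB'] : pairing (W :\: [set e.1; (a f).1]) a /\
        bridgeless (W :\: [set e.1; (a f).1]) a.
      apply: bridgeless_drop => //; first exact: sub.
      move=> x; rewrite in_setD => /andP[xU xW]; apply: contra xU.
      rewrite !inE => /orP[] /eqP ax.
        by have := H _ ax; rewrite !inE => /or3P[] /eqP E; rewrite -(inv x xW) E;
          rewrite -?afg -?afe eqxx orbT.
      have := darts3_all (esym afg) (esym afe) uv ax; rewrite !inE.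
      by case/or3P => /eqP E; rewrite -(inv x xW) E inv // ?fe ?ge eqxx.
    have [|m' [mW _]] := IH _ a e (small _ _ eW) aW' _ noB'.
      by move=> x; rewrite in_setD => /andP[_ /aF].
    exact: (glue2 m' [::] a).
  have [t [tf uv]] := darts2 (esym afg) nafg.
  have tW : t.1 \in W by rewrite tf.
  have := uv; rewrite /= !inE negb_or !andbT => /andP[/andP[_ aft] agt].
  have atf : (a t).1 != e.1.
    apply/negP => /eqP /H; rewrite !inE => /or3P[] /eqP atE.
    - by move: afe; rewrite -atE inv // tf eqxx.
    - by move: aft; rewrite -atE inv // eqxx.
    - by move: agt; rewrite -atE inv // eqxx.
  have pW : (a e).1 \in W :\: [set e.1; (a f).1].
    by rewrite !inE negb_or lp // eq_sym afe clo.
  have qW : (a t).1 \in W :\: [set e.1; (a f).1].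
    by rewrite !inE negb_or atf -tf lp //= clo.
  have pq : a e != a t by apply: contra eu => /eqP /injW ->; rewrite ?tf.
  have sU x : x.1 \in W :\: [set e.1; (a f).1] ->
      ((a x).1 \in [set e.1; (a f).1]) = (x \in [:: a e; a t]).
    rewrite 2!inE negb_or in_set1 in_set1 -andbA => /and3P[xe xf xW].
    apply/idP/idP; rewrite !inE => /orP[] /eqP.
    - move/H; rewrite !inE => /or3P[] /eqP ax; move: xe xf; rewrite -(inv x xW) ax.
      + by rewrite eqxx.
      + by rewrite eqxx.
      + by rewrite afg eqxx.
    - move/(darts3_all (esym afg) tf uv); rewrite !inE => /or3P[] /eqP ax;
        move: xe xf; rewrite -(inv x xW) ax ?inv ?fe ?ge ?eqxx //.
      by rewrite orbT.
    - by move->; rewrite inv // eqxx.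
    - by move->; rewrite inv // tf eqxx orbT.
  have [aW' noB'] := bridgeless_splice aW (sub _ _ eW avu) pq pW qW sU noB.
  have [|m' [mW mp]] := IH _ _ (a e) (small _ _ eW) aW' _ noB'.
    by apply: fixfree_rewire => // x; rewrite in_setD => /andP[_ /aF].
  apply: (glue2 m' [:: a e; a t] _ aW' mW); last exact: rewire_off.
  move=> x; rewrite !inE => /orP[] /eqP->; first exact: mp.
  by rewrite -(rewirel a (a e) (a t)) (matchingE aW' mW pW) mp.
(* If [f] is parallel to [e], then [g] is parallel to neither, and [f] and [g] exchange their
   roles. *)
have [afe|afe] := boolP ((a f).1 == (a e).1); last exact: (frink f g).
apply: (frink g f) => //.
- by move: us; rewrite /= !inE !negb_or (eq_sym g) => /and3P[/andP[-> ->] ->].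
- by rewrite eq_sym.
- by rewrite -(eqP afe) eq_sym.
Qed.

End Matchings.

(** * Pairs of involutions *)

(** Applying [s] and [t] in turn from the fixed point [x] gives a path that can only stop at [y].
    The induction removes [x] and [s x] and makes [t (s x)] the new fixed point. *)
Lemma alternate_path (T : finType) (X : {set T}) (s t : T -> T) x y :
  (forall z, z \in X -> [/\ s z \in X, s (s z) = z & s z != z]) ->
  (forall z, z \in X -> t z \in X /\ t (t z) = z) ->
  (forall z, z \in X -> t z = z -> z = x \/ z = y) ->
  x \in X -> y \in X -> t x = x -> t y = y -> x != y ->
  exists (Y : {set T}) (b : T -> bool), [/\ Y \subset X, x \in Y, y \in Y &
    forall z, z \in Y -> [/\ s z \in Y, t z \in Y, b (s z) = ~~ b z & b (t z) = b z]].
Proof.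
have [n] := ubnP #|X|; elim: n => // n IH in X t x *; rewrite ltnS => Xn.
move=> sX tX tF xX yX tx ty xy.
have [zX sz zx] := sX _ xX; set z := s x in zX sz zx.
have [zy|zy] := eqVneq z y.
  exists [set x; y], (pred1 x); split; rewrite ?inE ?eqxx ?orbT //.
    by rewrite subUset !sub1set xX yX.
  move=> w; rewrite !inE => /orP[] /eqP->.
    by rewrite /= -/z zy tx !eqxx orbT (eq_sym y x) (negbTE xy).
  have sy : s y = x by rewrite -zy.
  by rewrite /= sy ty !eqxx orbT (eq_sym y x) (negbTE xy).
have [qX tq] := tX _ zX; set q := t z in qX tq.
have qz : q != z by apply/eqP => /(tF _ zX) [] /eqP; apply/negP.
have qx : q != x by apply/eqP => E; move: zx; rewrite -tq E tx eqxx.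
have qy : q != y by apply/eqP => E; move: zy; rewrite -tq E ty eqxx.
pose X' := X :\: [set x; z]; pose t' w := if w == q then q else t w.
have inX' w : (w \in X') = [&& w != x, w != z & w \in X].
  by rewrite !inE negb_or andbA.
have qX' : q \in X' by rewrite inX' qx qz.
have yX' : y \in X' by rewrite inX' yX eq_sym xy eq_sym zy.
have X'n : #|X'| < n.
  apply: leq_trans Xn; apply: proper_card; apply/properP; rewrite subsetDl.
  by split=> //; exists x; rewrite // inX' eqxx.
have t'off w : w != q -> t' w = t w by rewrite /t' => /negbTE->.
have t'q : t' q = q by rewrite /t' eqxx.
have t'y : t' y = y by rewrite t'off // eq_sym.
have [w|w|w|Y [b [sY qY yY H]]] := IH X' t' q X'n _ _ _ qX' yX' t'q t'y qy.
- rewrite inX' => /and3P[wx wz wX]; have [swX ssw sww] := sX _ wX.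
  split=> //; rewrite inX' swX andbT; apply/andP; split; apply/eqP => E.
    by move: wz; rewrite -ssw E eqxx.
  by move: wx; rewrite -ssw E sz eqxx.
- have [->|wq] := eqVneq w q; first by rewrite !t'q.
  rewrite t'off // inX' => /and3P[wx wz wX]; have [twX ttw] := tX _ wX.
  have nq : t w != q by apply/eqP => E; move: wz; rewrite -ttw E tq eqxx.
  split; last by rewrite t'off.
  rewrite inX' twX andbT; apply/andP; split; apply/eqP => E.
    by move: wx; rewrite -ttw E tx eqxx.
  by move: wq; rewrite -ttw E eqxx.
- rewrite inX' => /and3P[wx wz wX]; have [->|wq] := eqVneq w q; first by left.
  rewrite t'off // => /(tF _ wX) []; last by right.
  by move/eqP; rewrite (negbTE wx).
have notY w : w \in Y -> w != x /\ w != z.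
  by move/(subsetP sY); rewrite inX' => /and3P[].
exists (x |: (z |: Y)), (fun w => if w == z then b q else if w == x then ~~ b q else b w).
split; rewrite ?inE ?eqxx ?yY ?orbT //.
  by rewrite !subUset !sub1set xX zX (subset_trans sY) ?subsetDl.
move=> w; rewrite !inE => /or3P[/eqP->|/eqP->|wY].
- by rewrite -/z tx !eqxx orbT /= (eq_sym x) (negbTE zx) negbK.
- rewrite sz -/q qY !eqxx !orbT /= (eq_sym x) (negbTE zx).
  by rewrite (negbTE qx) (negbTE qz).
have [wx wz] := notY _ wY; have [swY twY bs bt] := H _ wY.
have [sx sz'] := notY _ swY.
rewrite swY (negbTE wx) (negbTE wz) (negbTE sx) (negbTE sz') !orbT.
have [wq|wq] := eqVneq w q; first by rewrite wq tq eqxx orbT -wq.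
have := notY _ twY; move: twY bt; rewrite t'off // => -> -> [/negbTE-> /negbTE->].
by rewrite !orbT.
Qed.

(** The union of two perfect matchings consists of even cycles. The induction removes [x] and [s x]
    and joins their [t]-partners, which shortens a cycle by two; a cycle of length two is removed
    whole. *)
Lemma two_involutions (T : finType) (X : {set T}) (s t : T -> T) :
  (forall z, z \in X -> [/\ s z \in X, s (s z) = z & s z != z]) ->
  (forall z, z \in X -> [/\ t z \in X, t (t z) = z & t z != z]) ->
  exists b : T -> bool,
    forall z, z \in X -> b (s z) = ~~ b z /\ b (t z) = ~~ b z.
Proof.
have [n] := ubnP #|X|; elim: n => // n IH in X t *; rewrite ltnS => Xn sX tX.
have [X0|[x xX]] := set_0Vmem X; first by exists xpredT => z; rewrite X0 inE.
have [zX sz zx] := sX _ xX; set z := s x in zX sz zx.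
have [pX tp px] := tX _ xX; set p := t x in pX tp px.
have [qX tq qz] := tX _ zX; set q := t z in qX tq qz.
pose X' := X :\: [set x; z].
have inX' w : (w \in X') = [&& w != x, w != z & w \in X].
  by rewrite !inE negb_or andbA.
have X'n : #|X'| < n.
  apply: leq_trans Xn; apply: proper_card; apply/properP; rewrite subsetDl.
  by split=> //; exists x; rewrite // inX' eqxx.
have sX' w : w \in X' -> [/\ s w \in X', s (s w) = w & s w != w].
  rewrite inX' => /and3P[wx wz wX]; have [swX ssw sww] := sX _ wX.
  split=> //; rewrite inX' swX andbT; apply/andP; split; apply/eqP => E.
    by move: wz; rewrite -ssw E eqxx.
  by move: wx; rewrite -ssw E sz eqxx.
have [pz|pz] := eqVneq p z.
  have qx : q = x by rewrite /q -pz tp.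
  have [w|b H] := IH X' t X'n sX'.
    rewrite inX' => /and3P[wx wz wX]; have [twX ttw tww] := tX _ wX.
    split=> //; rewrite inX' twX andbT; apply/andP; split; apply/eqP => E.
      by move: wz; rewrite -ttw E -/p pz eqxx.
    by move: wx; rewrite -ttw E -/q qx eqxx.
  exists (fun w => if w == x then true else if w == z then false else b w) => w wX.
  have [->|wx] := eqVneq w x; first by rewrite -/z -/p pz eqxx (negbTE zx).
  have [->|wz] := eqVneq w z; first by rewrite sz -/q qx eqxx.
  have wX' : w \in X' by rewrite inX' wx wz.
  have [-> ->] := H _ wX'; have [+ _ _] := sX' _ wX'.
  rewrite inX' => /and3P[/negbTE-> /negbTE-> _].
  have [_ ttw _] := tX _ wX.
  case: eqP => [E|_]; first by move: wz; rewrite -ttw E -/p pz eqxx.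
  by case: eqP => [E|_] //; move: wx; rewrite -ttw E -/q qx eqxx.
have qx : q != x by apply: contra pz => /eqP E; rewrite /p -E tq.
have pq : p != q by apply: contra zx => /eqP E; rewrite -tp E tq.
have pX' : p \in X' by rewrite inX' px pz.
have qX' : q \in X' by rewrite inX' qx qz.
pose t' w := if w == p then q else if w == q then p else t w.
have t'p : t' p = q by rewrite /t' eqxx.
have t'q : t' q = p by rewrite /t' eqxx eq_sym (negbTE pq).
have t'off w : w != p -> w != q -> t' w = t w by rewrite /t' => /negbTE-> /negbTE->.
have toff w : w \in X' -> w != p -> w != q -> [/\ t w \in X', t w != p & t w != q].
  rewrite inX' => /and3P[wx wz wX] wp wq; have [twX ttw tww] := tX _ wX.
  rewrite inX' twX andbT; split; [apply/andP; split|..]; apply/eqP => E.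
  - by move: wp; rewrite -ttw E eqxx.
  - by move: wq; rewrite -ttw E eqxx.
  - by move: wx; rewrite -ttw E tp eqxx.
  - by move: wz; rewrite -ttw E tq eqxx.
have [w wX'|b H] := IH X' t' X'n sX'.
  have [->|wp] := eqVneq w p; first by rewrite t'p t'q eq_sym.
  have [->|wq] := eqVneq w q; first by rewrite t'q t'p.
  have [? ? ?] := toff _ wX' wp wq; rewrite !t'off //; split=> //.
    by have := wX'; rewrite inX' => /and3P[_ _ /tX[]].
  by have := wX'; rewrite inX' => /and3P[_ _ /tX[]].
have bq : b q = ~~ b p by have [_] := H _ pX'; rewrite t'p.
exists (fun w => if w == x then ~~ b p else if w == z then ~~ b q else b w) => w wX.
have [->|wx] := eqVneq w x.
  by rewrite -/z -/p eqxx (negbTE zx) (negbTE px) (negbTE pz) bq !negbK.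
have [->|wz] := eqVneq w z.
  by rewrite sz -/q eqxx (negbTE qx) (negbTE qz) bq !negbK.
have wX' : w \in X' by rewrite inX' wx wz.
have [bs bt] := H _ wX'; have [+ _ _] := sX' _ wX'.
rewrite inX' => /and3P[/negbTE-> /negbTE-> _]; split=> //.
have [->|wp] := eqVneq w p; first by rewrite tp eqxx.
have [->|wq] := eqVneq w q; first by rewrite tq (negbTE zx) eqxx.
have [+ _ _] := toff _ wX' wp wq; rewrite inX' => /and3P[/negbTE-> /negbTE-> _].
by rewrite -bt t'off.
Qed.

(** * Semi-colouring cubic pairings *)

Section PairingColorings.

Variable V : finType.
Implicit Types (W S U : {set V}) (a : V * 'I_3 -> V * 'I_3).
Implicit Types (x y z p q : V * 'I_3) (c : V * 'I_3 -> 'I_3 * bool).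

(* [(i, false)] encodes the colour i, and [(i, true)] the pair of the two
   colours other than i, so that an edge of colour i completes two edges of
   colour [(i, true)] at a cubic vertex. *)
Definition good_at c (w : V) : Prop :=
  (forall i j, (c (w, i)).2 = false /\ ((c (w, i)).1 = (c (w, j)).1 -> i = j)) \/
  (exists i0 k, forall i, c (w, i) = (k, i != i0)).

(* A dart fixed by [a] is a dangling half-edge. *)
Definition good_coloring W a c : Prop :=
  [/\ forall x, x.1 \in W -> c (a x) = c x,
      forall x, x.1 \in W -> a x = x -> (c x).2 = false &
      forall w, w \in W -> good_at c w].

Definition dangling W a : {set V * 'I_3} := [set x | (x.1 \in W) && (a x == x)].

Lemma eq_good_at c c' w : (forall i, c (w, i) = c' (w, i)) -> good_at c w -> good_at c' w.
Proof.
move=> E [H|[i0 [k H]]]; first by left=> i j; rewrite -!E.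
by right; exists i0, k => i; rewrite -E.
Qed.

Lemma good_at_perm c w (f : 'I_3 -> 'I_3) : injective f ->
  good_at c w -> good_at (fun x => (f (c x).1, (c x).2)) w.
Proof.
move=> fI [H|[i0 [k H]]]; first by left=> i j; have [? E] := H i j; split=> //= /fI.
by right; exists i0, (f k) => i; rewrite H.
Qed.

(** The two unmatched darts at a vertex carry the same pair. Dangling darts have to be matched
    because a mixed colour is forbidden there. *)
Lemma matching_coloring W a m : pairing W a -> matching W a m ->
  (forall x, x.1 \in W -> a x = x -> m x.1 = x.2) ->
  good_coloring W a (fun x => (ord0, x.2 != m x.1)).
Proof.
move=> aW mW mF; split=> [x xW|x xW ax|w _] /=.
- by rewrite !(eq_sym _ (m _)) (matchingE aW mW).
- by rewrite mF // eqxx.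
- by right; exists (m w), ord0.
Qed.

(** This is one side of a cut bridge: [rewire a x x] turns the dart of the bridge in [S] into a
    dangling one. *)
Lemma pairing_cap W S a x : pairing W a -> S \subset W -> x.1 \in S ->
  (a x).1 \notin S -> (forall z, z.1 \in S -> (a z).1 \notin S -> z = x) ->
  pairing S (rewire a x x) /\ #|dangling S (rewire a x x)| <= #|dangling W a|.+1.
Proof.
move=> aW sS xS axS ux; have sW v := subsetP sS v; split.
  move=> z zS _; have [_ aaz] := pairingP aW (sW _ zS).
  have [->|zx] := eqVneq z x; first by rewrite !rewirel.
  have off w : w != x -> rewire a x x w = a w.
    by move=> wx; rewrite rewire_off // !inE (negbTE wx).
  have azS : (a z).1 \in S by apply: contraR zx => /(ux _ zS)->.
  rewrite off //; split=> //; rewrite off //; apply: contra axS => /eqP <-.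
  by rewrite aaz.
apply: leq_trans (_ : #|x |: dangling W a| <= _); last first.
  by rewrite cardsU1; case: (x \notin _) => //=; rewrite leqnSn.
apply/subset_leq_card/subsetP => z; rewrite !inE /rewire => /andP[zS].
by have [//|zx] := eqVneq z x; rewrite (sW _ zS).
Qed.

(** Delete the vertex of [x], join the far darts of its two other edges, and take a matching that
    avoids the joined edge; [x] is then matched with itself. *)
Lemma matching_dangling W a x : pairing W a -> bridgeless W a ->
  dangling W a = [set x] -> exists m, matching W a m /\ m x.1 = x.2.
Proof.
move=> aW noB Dx.
have xin : x \in dangling W a by rewrite Dx inE.
have := xin; rewrite inE => /andP[xW /eqP ax].
have fx z : z.1 \in W -> a z = z -> z = x.
  by move=> zW az; apply/set1P; rewrite -Dx inE zW az eqxx.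
have [y [z [yx zx us H]]] := darts3 x.
have := us; rewrite /= !inE negb_or !andbT => /andP[/andP[xy xz] yz].
have [yW zW] : y.1 \in W /\ z.1 \in W by rewrite yx zx.
have inv w : w.1 \in W -> a (a w) = w by case/(pairingP aW).
have clo w : w.1 \in W -> (a w).1 \in W by case/(pairingP aW).
have sub : [set x.1] \subset W by rewrite sub1set.
have inW' w : (w \in W :\: [set x.1]) = (w != x.1) && (w \in W) by rewrite !inE.
have F' w : w.1 \in W :\: [set x.1] -> a w != w.
  by rewrite inW' => /andP[wx wW]; apply: contra wx => /eqP /(fx _ wW) ->.
have glue (m' : V -> 'I_3) (s : seq (V * 'I_3)) (a' : V * 'I_3 -> V * 'I_3) (W' := W :\: [set x.1]) :
    pairing W' a' -> matching W' a' m' -> (forall w, w \in s -> m' w.1 != w.2) ->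
    (forall w, w \notin s -> a' w = a w) -> exists m, matching W a m /\ m x.1 = x.2.
  move=> aW' mW ms a'E; pose m (w : V) := if w == x.1 then x.2 else m' w.
  have mx : m x.1 = x.2 by rewrite /m eqxx.
  exists m; split=> //; apply: (matching_glue (m := m) (s := s) aW' mW).
  - by move=> w; rewrite inW' /m => /andP[/negbTE->].
  - by move=> w _; apply: a'E.
  - by move=> w _ /ms /eqP.
  - by move=> w /set1P ->; rewrite mx -surjective_pairing ax.
have nfix w : w.1 = x.1 -> w != x -> a w != w /\ a w != x.
  move=> wx nwx; have wW : w.1 \in W by rewrite wx.
  split; first by apply: contra nwx => /eqP /(fx _ wW) ->.
  by apply: contra nwx => /eqP E; rewrite -(inv _ wW) E ax.
have [ayy ayx] : a y != y /\ a y != x by apply: nfix; rewrite // eq_sym.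
have [azz azx] : a z != z /\ a z != x by apply: nfix; rewrite // eq_sym.
(* If [y] and [z] form a loop, the vertex of [x] is a component of its own and nothing has to be
   joined. *)
have [ayz|ayz] := eqVneq (a y) z.
  have [|aW' noB'] := bridgeless_drop aW sub _ noB.
    move=> w; rewrite inW' in_set1 => /andP[wx wW]; apply: contra wx => /eqP /H.
    rewrite !inE => /or3P[] /eqP E; rewrite -(inv _ wW) E ?ax ?ayz ?zx //.
    by rewrite -ayz inv // yx.
  have [m' [mW _]] := petersen x aW' F' noB'.
  exact: (glue m' [::] a).
have azy : a z != y by apply: contra ayz => /eqP <-; rewrite inv.
have pW : (a y).1 \in W :\: [set x.1].
  rewrite inW' clo // andbT; apply/eqP => /H; rewrite !inE.
  by rewrite (negbTE ayx) (negbTE ayy) (negbTE ayz).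
have qW : (a z).1 \in W :\: [set x.1].
  rewrite inW' clo // andbT; apply/eqP => /H; rewrite !inE.
  by rewrite (negbTE azx) (negbTE azy) (negbTE azz).
have pq : a y != a z by apply: contra yz => /eqP E; rewrite -(inv y) // E inv.
have [|aW' noB'] := bridgeless_splice aW sub pq pW qW _ noB.
  move=> w; rewrite inW' in_set1 => /andP[wx wW]; apply/idP/idP.
    move=> /eqP/H; rewrite !inE => /or3P[] /eqP E; move: wx;
      by rewrite -(inv _ wW) E ?ax ?eqxx ?orbT.
  by rewrite !inE => /orP[] /eqP->; rewrite inv // ?yx ?zx.
have [|m' [mW mp]] := petersen (a y) aW' _ noB'.
  by apply: fixfree_rewire => // w wW _; apply: F'.
apply: (glue m' [:: a y; a z] _ aW' mW); last exact: rewire_off.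
move=> w; rewrite !inE => /orP[] /eqP->; first exact: mp.
by rewrite -(rewirel a (a y) (a z)) (matchingE aW' mW pW) mp.
Qed.

(** The other mixed dart at the vertex of [z], hence the next step along a mixed cycle; the default
    [z] does not occur for a mixed dart of a good colouring. *)
Definition mate c z := odflt z [pick w | [&& w.1 == z.1, w != z & (c w).2]].

Lemma mateP c z : good_at c z.1 -> (c z).2 ->
  [/\ (mate c z).1 = z.1, mate c z != z, c (mate c z) = c z &
      forall w, w.1 = z.1 -> w != z -> w != mate c z -> c w = ((c z).1, false)].
Proof.
case: z => u i /= [H|[i0 [k H]]] cz; first by have [] := H i i; rewrite cz.
have := cz; rewrite {1}H /= => ii0.
have ni0 : (u, i) != (u, i0) by rewrite xpair_eqE eqxx.
have H2 w : w.1 = u -> c w = (k, w != (u, i0)).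
  by case: w => u' j /= ->; rewrite H xpair_eqE eqxx.
have [t [/= tu ut]] := darts2 (erefl : (u, i0).1 = (u, i).1) ni0.
have := ut; rewrite /= !inE negb_or !andbT => /andP[/andP[_ ti] ti0].
rewrite /mate; case: pickP => [w /= /and3P[/eqP wu wi cw]|/(_ t)]; last first.
  by rewrite H2 //= tu eqxx !(eq_sym t) ti ti0.
have w0 : w != (u, i0) by move: cw; rewrite H2.
rewrite [c (u, i)]H2 // ni0; split=> //; first by rewrite H2 // w0.
move=> v vu vi vw; rewrite H2 //; congr (_, _).
have uw : uniq [:: (u, i); (u, i0); w].
  by rewrite /= !inE negb_or ni0 !(eq_sym _ w) wi w0.
have := darts3_all (x := (u, i)) (y := (u, i0)) erefl wu uw vu.
by rewrite !inE (negbTE vi) (negbTE vw) orbF /= => ->.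
Qed.

Lemma mateK c z : good_at c z.1 -> (c z).2 -> mate c (mate c z) = z.
Proof.
move=> gz cz; have [s1 sz cs us] := mateP gz cz.
have [||s1' sz' cs' _] := mateP (c := c) (z := mate c z); rewrite ?s1 ?cs //.
apply/eqP; apply: contraT => E; move: cs'; rewrite us ?s1' ?cs // => /(congr1 snd).
by rewrite cz.
Qed.

(** If the joined edge is pure, both halves keep its colour. If it is mixed, alternating [mate] and
    [a] leads from [x] to [y], and the edges of this path take the two colours of the pair in
    turn. *)
Lemma open_cycle W a x y c : pairing W a -> x.1 \in W -> y.1 \in W ->
  a x = x -> a y = y -> x != y -> good_coloring W (rewire a x y) c ->
  exists c', good_coloring W a c'.
Proof.
move=> aW xW yW ax ay xy [cI cF cL].
have inv w : w.1 \in W -> a (a w) = w by case/(pairingP aW).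
have clo w : w.1 \in W -> (a w).1 \in W by case/(pairingP aW).
have cxy : c y = c x by rewrite -(cI _ xW) rewirel.
have off z : z != x -> z != y -> rewire a x y z = a z.
  by move=> zx zy; rewrite rewire_off // !inE negb_or zx.
have cA z : z.1 \in W -> c (a z) = c z.
  move=> zW; have [->|zx] := eqVneq z x; first by rewrite ax.
  have [->|zy] := eqVneq z y; first by rewrite ay.
  by rewrite -off // cI.
have cD z : z.1 \in W -> z != x -> z != y -> a z = z -> (c z).2 = false.
  by move=> zW zx zy az; apply: cF; rewrite // off.
have [xs|xm] := boolP ((c x).2 == false).
  exists c; split=> // z zW az.
  have [->|zx] := eqVneq z x; first exact/eqP.
  have [->|zy] := eqVneq z y; first by rewrite cxy; apply/eqP.
  exact: cD.
pose k := (c x).1; pose X := [set z | (z.1 \in W) && (c z == (k, true))].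
have cx : c x = (k, true) by rewrite /k; case: (c x) xm => ? [].
have sX z : z \in X -> [/\ mate c z \in X, mate c (mate c z) = z & mate c z != z].
  rewrite !inE => /andP[zW /eqP cz].
  have [s1 sz cs us] := mateP (cL _ zW) (congr1 snd cz).
  by rewrite s1 cs cz eqxx zW mateK ?cz //; apply: cL.
have tX z : z \in X -> a z \in X /\ a (a z) = z.
  by rewrite !inE => /andP[zW /eqP cz]; rewrite clo // cA // cz inv ?eqxx.
have fX z : z \in X -> a z = z -> z = x \/ z = y.
  rewrite inE => /andP[zW /eqP cz] az.
  have [->|zx] := eqVneq z x; first by left.
  have [->|zy] := eqVneq z y; first by right.
  by have := cD _ zW zx zy az; rewrite cz.
have xX : x \in X by rewrite inE xW cx eqxx.
have yX : y \in X by rewrite inE yW cxy cx eqxx.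
have [Y [b [sY xY yY HY]]] := alternate_path sX tX fX xX yX ax ay xy.
have [j' [l' [kj kl jl]]] : exists j l : 'I_3, [/\ k != j, k != l & j != l].
  by case: (k) => [[|[|[|//]]] ?]; [exists (inord 1), (inord 2)
    |exists (inord 0), (inord 2)|exists (inord 0), (inord 1)];
    rewrite -!val_eqE /= !inordK.
pose c' z := if z \in Y then (if b z then j' else l', false) else c z.
exists c'; rewrite /c'.
split=> [z zW|z zW az|w wW].
- have [zY|zY] := boolP (z \in Y); first by have [_ -> _ ->] := HY _ zY.
  have -> : a z \in Y = false by apply: contraNF zY => /HY[_]; rewrite inv.
  exact: cA.
- case: ifP => // /negbT zY; apply: cD => //.
    by apply: contra zY => /eqP->.
  by apply: contra zY => /eqP->.
(* As [Y] is closed under [mate], the path contains both mixed darts of a vertex or none. In the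
   first case they receive [j'] and [l'], and the third dart already has the colour [k]. *)
have [[i iY]|nY] : (exists i, (w, i) \in Y) \/ (forall i, (w, i) \notin Y).
  have [/existsP|] := boolP [exists i, (w, i) \in Y]; first by left.
  by rewrite negb_exists => /forallP; right.
  have zX := subsetP sY _ iY; have := zX; rewrite inE => /andP[_ /eqP cwi].
  have [s1 sz cs us] := mateP (cL _ wW) (congr1 snd cwi); rewrite cwi in cs us.
  have [sY' _ bs _] := HY _ iY.
  have cz : c' (w, i) = (if b (w, i) then j' else l', false) by rewrite /c' iY.
  have cs' : c' (mate c (w, i)) = (if b (w, i) then l' else j', false).
    by rewrite /c' sY' bs; case: (b _).
  have co v : v.1 = w -> v != (w, i) -> v != mate c (w, i) -> c' v = (k, false).
    move=> vw v1 v2; rewrite /c' us //; case: ifP => // /(subsetP sY).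
    by rewrite inE us // => /andP[_ /eqP[]].
  left=> i1 i2; rewrite -/(c' (w, i1)) -/(c' (w, i2)).
  suff [e1 e2] : (c' (w, i1)).2 = false /\
      ((c' (w, i1)).1 = (c' (w, i2)).1 -> (w, i1) = (w, i2)).
    by split=> // /e2 [].
  have : (w, i2).1 = w by []. have : (w, i1).1 = w by [].
  move: (w, i1) (w, i2) => v1 v2 w1 w2.
  have [->|n1] := eqVneq v1 (w, i).
    rewrite cz; split=> //; have [//|m1] := eqVneq v2 (w, i).
    have [->|m2] := eqVneq v2 (mate c (w, i)); last rewrite co //=; last first.
      by case: (b _) => /eqP; rewrite eq_sym ?(negbTE kj) ?(negbTE kl).
    by rewrite cs'; case: (b _) => /= /eqP; rewrite ?(negbTE jl) // eq_sym (negbTE jl).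
  have [->|n2] := eqVneq v1 (mate c (w, i)).
    rewrite cs'; split=> //; have [//|m2] := eqVneq v2 (mate c (w, i)).
    have [->|m1] := eqVneq v2 (w, i); last rewrite co //=; last first.
      by case: (b _) => /eqP; rewrite eq_sym ?(negbTE kj) ?(negbTE kl).
    by rewrite cz; case: (b _) => /= /eqP; rewrite ?(negbTE jl) // eq_sym (negbTE jl).
  rewrite co //; split=> //=.
  have [->|m1] := eqVneq v2 (w, i).
    by rewrite cz; case: (b _) => /eqP; rewrite ?(negbTE kj) ?(negbTE kl).
  have [->|m2] := eqVneq v2 (mate c (w, i)).
    by rewrite cs'; case: (b _) => /eqP; rewrite ?(negbTE kj) ?(negbTE kl).
  move=> _; have uv : uniq [:: (w, i); mate c (w, i); v1].
    by rewrite /= !inE negb_or (eq_sym _ (mate _ _)) sz !(eq_sym _ v1) n1 n2.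
  have := darts3_all s1 w1 uv w2; rewrite !inE (negbTE m1) (negbTE m2) /=.
  by move/eqP.
by apply: eq_good_at (cL _ wW) => i; rewrite (negbTE (nY i)).
Qed.

Lemma good_coloring_exists W a : pairing W a -> exists c, good_coloring W a c.
Proof.
(* Each side of a cut bridge loses at least one vertex and gains at most one dangling dart; joining
   two dangling darts keeps the vertices. The measure drops both times. *)
have [n] := ubnP (4 * #|W| + #|dangling W a|).
elim: n => // n IH in W a *; rewrite ltnS => Wn aW.
have inv w : w.1 \in W -> a (a w) = w by case/(pairingP aW).
have clo w : w.1 \in W -> (a w).1 \in W by case/(pairingP aW).
have [noB|/bridgelessPn[S sS /eqP]] := boolP (bridgeless W a); last first.
  case/cards1P => x Ex.
  have cr z : (z.1 \in S) && ((a z).1 \in W :\: S) = (z == x).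
    by have := in_set1 z x; rewrite -Ex inE.
  have := cr x; rewrite eqxx in_setD => /and3P[xS axS axW].
  have sW v := subsetP sS v.
  have ux z : z.1 \in S -> (a z).1 \notin S -> z = x.
    by move=> zS azS; apply/eqP; rewrite -cr zS in_setD azS clo ?sW.
  have ux' z : z.1 \in W :\: S -> (a z).1 \notin W :\: S -> z = a x.
    rewrite in_setD => /andP[zS zW]; rewrite in_setD clo // andbT negbK => azS.
    by rewrite -(inv z zW) (ux (a z)) // inv.
  have [pS dS] := pairing_cap aW sS xS axS ux.
  have ayW : (a x).1 \in W :\: S by rewrite in_setD axS.
  have aax : (a (a x)).1 \notin W :\: S by rewrite inv ?sW // in_setD xS.
  have [pT dT] := pairing_cap aW (subsetDl W S) ayW aax ux'.
  have [|c1 [I1 F1 L1]] := IH S _ _ pS.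
    have : #|S| < #|W|.
      by apply/proper_card/properP; split=> //; exists (a x).1.
    by move: dS Wn; clear; lia.
  have [|c2 [I2 F2 L2]] := IH (W :\: S) _ _ pT.
    have : #|W :\: S| < #|W|.
      apply/proper_card/properP; split; first exact: subsetDl.
      by exists x.1; rewrite ?sW // in_setD xS.
    by move: dT Wn; clear; lia.
  (* Both halves of the bridge are dangling and therefore pure, so a transposition of colours makes
     them agree. *)
  pose f := tperm (c1 x).1 (c2 (a x)).1.
  exists (fun z => if z.1 \in S then c1 z else (f (c2 z).1, (c2 z).2)).
  have sx : (c1 x).2 = false by apply: F1; rewrite // rewirel.
  have sy : (c2 (a x)).2 = false by apply: F2; rewrite // rewirel.
  have off p z : z != p -> rewire a p p z = a z.
    by move=> zp; rewrite rewire_off // !inE (negbTE zp).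
  have agree : c1 x = (f (c2 (a x)).1, (c2 (a x)).2).
    by rewrite /f tpermR sy -sx; case: (c1 x).
  split=> [z zW|z zW az|w wW].
  - have [zS|zS] := boolP (z.1 \in S).
      have [->|zx] := eqVneq z x; first by rewrite (negbTE axS) agree.
      have azS : (a z).1 \in S by apply: contraR zx => /(ux _ zS) ->.
      by rewrite azS -(off x) // I1.
    have zT : z.1 \in W :\: S by rewrite in_setD zS.
    have [->|zx] := eqVneq z (a x); first by rewrite inv ?sW // xS agree.
    have azT : (a z).1 \in W :\: S by apply: contraR zx => /(ux' _ zT) ->.
    have := azT; rewrite in_setD => /andP[/negbTE-> _].
    by rewrite -(off (a x)) // I2.
  - have [zS|zS] := boolP (z.1 \in S).
      apply: F1; rewrite // off //.
      by apply: contra axS => /eqP <-; rewrite az.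
    have zT : z.1 \in W :\: S by rewrite in_setD zS.
    apply: F2; rewrite // off //; apply: contra zS => /eqP E.
    by rewrite -az E inv ?sW.
  - have [wS|wS] := boolP (w \in S).
      by apply: eq_good_at (L1 _ wS) => i; rewrite /= wS.
    have wT : w \in W :\: S by rewrite in_setD wS.
    by apply: eq_good_at (good_at_perm (@perm_inj _ f) (L2 _ wT)) => i; rewrite /= (negbTE wS).
have [D0|[x xD]] := set_0Vmem (dangling W a).
  have [W0|[w wW]] := set_0Vmem W.
    by exists (fun=> (ord0, false)); split=> [x|x|w]; rewrite W0 inE.
  have aF : fixfree W a.
    by move=> x xW; apply/negP => ax; have := in_set0 x; rewrite -D0 inE xW ax.
  have [m [mW _]] := petersen (w, ord0) aW aF noB; eexists.
  apply: (matching_coloring aW mW) => x xW /eqP ax.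
  by have := aF _ xW; rewrite ax.
have [D1|[y]] := set_0Vmem (dangling W a :\ x).
  have Dx : dangling W a = [set x].
    by rewrite -(setD1K xD) D1 setU0.
  have [m [mW mx]] := matching_dangling aW noB Dx; eexists.
  apply: (matching_coloring aW mW) => z zW az.
  suff -> : z = x by [].
  by apply/set1P; rewrite -Dx inE zW az eqxx.
rewrite in_setD1 => /andP[yx yD].
have := xD; rewrite inE => /andP[xW /eqP ax].
have := yD; rewrite inE => /andP[yW /eqP ay].
have aW' : pairing W (rewire a x y).
  apply: pairing_off_rewire => // z zW zs; have [? ?] := pairingP aW zW; split=> //.
  by apply: contra zs; rewrite !inE => /orP[] /eqP E; rewrite -(inv _ zW) E ?ax ?ay eqxx ?orbT.
have [|c cW] := IH W _ _ aW'; last by apply: (open_cycle aW _ _ ax ay _ cW); rewrite // eq_sym.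
apply: leq_trans Wn; rewrite ltn_add2l; apply/proper_card/properP; split.
  apply/subsetP => z; rewrite !inE => /andP[-> /eqP]; rewrite /rewire.
  case: (eqVneq z x) => [->|_]; first by move/eqP; rewrite (negbTE yx).
  case: (eqVneq z y) => [->|_ az]; last by rewrite az eqxx.
  by move/eqP; rewrite eq_sym (negbTE yx).
by exists x; rewrite // inE xW rewirel (negbTE yx).
Qed.

End PairingColorings.

(** * Semi-colouring multigraphs *)

Lemma inj_to3_onto (T : finType) (A : {set T}) (f : T -> 'I_3) :
  #|A| = 3 -> {in A &, injective f} -> forall i, exists2 h, h \in A & f h = i.
Proof.
move=> A3 fI i; have : f @: A = setT.
  by apply/eqP; rewrite eqEcard subsetT cardsT card_ord card_in_imset // A3.
by move/setP/(_ i); rewrite in_setT => /imsetP[h hA ->]; exists h.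
Qed.

(** * Multigraphs of degree at most 3 as cubic pairings *)

Section Darts.

Variables (V : finType) (G : mgraph V).
Hypothesis deg3 : forall v, degree G v <= 3.
Implicit Types (h : edge G * bool).

Definition flip h := (h.1, ~~ h.2).

Definition slot h : 'I_3 :=
  inord (index h (enum (halfedges G (endpoint h.1 h.2)))).

Definition dart h : V * 'I_3 := (endpoint h.1 h.2, slot h).

(** Slots not taken by a half-edge are fixed, so a vertex of smaller degree becomes a cubic one with
    dangling half-edges. *)
Definition dart_pairing x : V * 'I_3 :=
  if [pick h | dart h == x] is Some h then dart (flip h) else x.

Lemma slot_inj v : {in halfedges G v &, injective slot}.
Proof.
move=> h h'; rewrite !inE => /eqP hv /eqP hv'.
have lt k : endpoint k.1 k.2 = v -> index k (enum (halfedges G v)) < 3.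
  move=> kv; apply: leq_trans (deg3 v); rewrite /degree cardE index_mem mem_enum inE.
  exact/eqP.
rewrite /slot hv hv' => /(congr1 val); rewrite /= !inordK ?lt // => E.
by apply: (index_inj h (s := enum (halfedges G v))) E; rewrite mem_enum inE ?hv ?hv'.
Qed.

Lemma dart_inj : injective dart.
Proof.
move=> h h' [E1 E2]; apply: (@slot_inj (endpoint h'.1 h'.2)) => //; rewrite inE //.
by rewrite E1.
Qed.

Lemma dart_pairingE h : dart_pairing (dart h) = dart (flip h).
Proof.
rewrite /dart_pairing; case: pickP => [h' /eqP /dart_inj -> //|/(_ h)].
by rewrite eqxx.
Qed.

Lemma flipK : involutive flip.
Proof. by case=> e b; rewrite /flip /= negbK. Qed.

Lemma pairing_darts : pairing setT dart_pairing.
Proof.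
move=> x _ _; split; rewrite ?inE //; rewrite {2}/dart_pairing.
case: pickP => [h /eqP <-|E]; first by rewrite dart_pairingE flipK.
by rewrite /dart_pairing; case: pickP => // h; rewrite E.
Qed.

Section Colored.

Variable c : V * 'I_3 -> 'I_3 * bool.
Hypothesis cG : good_coloring setT dart_pairing c.

Definition edge_color (e : edge G) := c (dart (e, true)).

Lemma edge_colorE h : c (dart h) = edge_color h.1.
Proof.
case: h => e [] //; rewrite /edge_color; have [cI _ _] := cG.
by rewrite -[RHS](cI (dart (e, true))) ?inE // dart_pairingE.
Qed.

Lemma sum_halfedges (R : Type) (idx : R) (op : Monoid.com_law idx)
    (F : 'I_3 * bool -> R) v :
  \big[op/idx]_(h in halfedges G v) F (edge_color h.1) =
  \big[op/idx]_(j in slot @: halfedges G v) F (c (v, j)).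
Proof.
rewrite big_imset; last exact: slot_inj.
apply: eq_bigr => h; rewrite inE => /eqP hv.
by rewrite -edge_colorE /dart hv.
Qed.

(** A free slot is dangling and hence pure; forgetting it breaks no pair of mixed half-edges. *)
Lemma free_slot v j : j \notin slot @: halfedges G v -> (c (v, j)).2 = false.
Proof.
have [_ cF _] := cG; move=> jh; apply: cF; rewrite ?inE // /dart_pairing.
case: pickP => // h /eqP[hv hj]; case/imsetP: jh.
by exists h; rewrite // inE hv.
Qed.

End Colored.

End Darts.

Lemma card_setC1_3 (i : 'I_3) : #|[set~ i]| == 2.
Proof. by rewrite cardsC1 card_ord. Qed.

Definition to_semi_color (x : 'I_3 * bool) : semi_color 3 :=
  if x.2 then inr (exist _ [set~ x.1] (card_setC1_3 x.1)) else inl x.1.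

Section Counting.

Variables (V : finType) (c : V * 'I_3 -> 'I_3 * bool) (w : V).
Hypothesis cw : good_at c w.

Import GRing.Theory Num.Theory.

Lemma sum_color_weight (i : 'I_3) :
  (\sum_(j < 3) color_weight i (to_semi_color (c (w, j))) = 1)%R.
Proof.
case: cw => [H|[i0 [k H]]].
  have fI : injective (fun j => (c (w, j)).1) by move=> j j'; case: (H j j').
  have [j _ ji] := inj_to3_onto (etrans (cardsT _) (card_ord 3)) (in2W fI) i.
  rewrite (bigD1 j) //= big1 => [|l lj]; rewrite /to_semi_color.
    by have [-> _] := H j j; rewrite /= ji eqxx addr0.
  have [-> _] := H l l; rewrite /= -ji; case: eqP => // /fI E.
  by rewrite E eqxx in lj.
rewrite (bigD1 i0) //= H eqxx /= /to_semi_color /=.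
rewrite (eq_bigr (fun=> if i == k then 0 else 1 / 2)%R); last first.
  by move=> j ji; rewrite H ji /= !inE; case: (i == k).
rewrite sumr_const (eq_card (B := predC1 i0)) // cardC1 card_ord.
by case: (i == k); rewrite ?mul0rn ?addr0 // add0r.
Qed.

Lemma sum_mixed (i j : 'I_3) :
  let n := \sum_(l < 3) is_mixed i j (to_semi_color (c (w, l))) in n = 0 \/ n = 2.
Proof.
case: cw => [H|[i0 [k H]]] /=.
  by left; apply: big1 => l _; rewrite /to_semi_color; have [-> _] := H l l.
case E: ([set~ k] == [set i; j]); [right|left].
  rewrite (bigD1 i0) //= H eqxx /= (eq_bigr (fun=> 1)); last first.
    by move=> l li; rewrite H li /to_semi_color /= E.
  by rewrite sum1_card (eq_card (B := predC1 i0)) // cardC1 card_ord.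
by apply: big1 => l _; rewrite H /to_semi_color /=; case: (l != i0); rewrite //= E.
Qed.

End Counting.

Lemma semi_coloring_exists (V : finType) (G : mgraph V) : max_degree G = 3 ->
  exists c : edge G -> semi_color (max_degree G), semi_coloring c.
Proof.
move=> D3; have deg3 v : degree G v <= 3 by rewrite -D3 /max_degree; apply: leq_bigmax.
have [c cG] := good_coloring_exists (pairing_darts deg3).
(* The type of colours depends on [max_degree G], which is replaced by 3 throughout. *)
rewrite /semi_coloring; case: _ / (esym D3).
exists (fun e : edge G => to_semi_color (edge_color c e)) => v.
have gv : good_at c v by case: cG => _ _; apply; rewrite inE.
split=> [i|i j _].
  rewrite (sum_halfedges deg3 cG _ (fun x => color_weight i (to_semi_color x))).
  (* Over all three slots the weight is exactly 1, and leaving out free slots can only lower it. *)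
  rewrite -(sum_color_weight gv i) big_mkcond /=; apply: Num.Theory.ler_sum => j _.
  case: ifP => // _; rewrite /to_semi_color; case: (c (v, j)) => k [] /=; by case: ifP.
have -> : #|[set h in halfedges G v | is_mixed i j (to_semi_color (edge_color c h.1))]|
    = \sum_(l < 3) is_mixed i j (to_semi_color (c (v, l))).
  rewrite cardsE -sum1_card big_mkcondr /=.
  rewrite (eq_bigr (fun h => nat_of_bool (is_mixed i j (to_semi_color (edge_color c h.1))))).
    rewrite (sum_halfedges deg3 cG _ (fun x => nat_of_bool (is_mixed i j (to_semi_color x)))).
    rewrite big_mkcond; apply: eq_bigr => l _; case: ifP => // /negbT /(free_slot cG).
    by rewrite /to_semi_color => ->.
  by move=> h _; case: ifP.
exact: sum_mixed.
Qed.

(** * Tight products *)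

Section ThreeEdgeColored.

Variables (V : finType) (G : mgraph V) (k : edge G -> 'I_3).
Hypotheses (cubG : cubic G) (kP : proper_edge_coloring k).

Lemma color_at x i : exists2 h, h \in halfedges G x & k h.1 = i.
Proof. exact: inj_to3_onto (cubG x) (kP (v := x)) i. Qed.

(** The default [x] does not occur, since by [color_at] every colour is present at every vertex. *)
Definition across i x : V :=
  if [pick h in halfedges G x | k h.1 == i] is Some h
  then endpoint h.1 (~~ h.2) else x.

Lemma acrossE h : across (k h.1) (endpoint h.1 h.2) = endpoint h.1 (~~ h.2).
Proof.
rewrite /across; case: pickP => [h' /andP[hx /eqP E]|/(_ h)]; last by rewrite !inE !eqxx.
by rewrite (kP hx _ E) // inE.
Qed.

Lemma acrossP i x : [/\ across i (across i x) = x & across i x != x].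
Proof.
have [[e b] + <-] := color_at x i; rewrite inE => /eqP /= <-.
have E b' := acrossE (e, b'); move: (E b) (E (~~ b)) => /= -> ->; rewrite negbK.
split=> //; apply/eqP => Ex.
have [] : (e, ~~ b) = (e, b) by apply: (kP (v := endpoint e b)); rewrite ?inE /= ?Ex.
by case: b {Ex}.
Qed.

Lemma bipartition_avoiding m : exists b : V -> bool,
  forall i x, i != m -> b (across i x) = ~~ b x.
Proof.
(* Applied over a one-point vertex set, [darts3] just names the two colours other than [m]. *)
have [f [g [_ _ _ H]]] := darts3 (tt, m).
have P i z : z \in [set: V] ->
    [/\ across i z \in setT, across i (across i z) = z & across i z != z].
  by case: (acrossP i z) => -> ->; rewrite inE.
have [b bP] := two_involutions (P f.2) (P g.2).
exists b => i x im; have [bf bg] := bP x (in_setT _).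
have := H (tt, i) erefl; rewrite !inE xpair_eqE (negbTE im) andbF /=.
by case/orP => /eqP E; move: bf bg; rewrite -E.
Qed.

End ThreeEdgeColored.

(** * The product graph and its two projections *)

Section TightProduct.

Variables (V1 V2 : finType) (G1 : mgraph V1) (k : edge G1 -> 'I_3).
Hypotheses (cub1 : cubic G1) (kP : proper_edge_coloring k).
Variables (a : V2 * 'I_3 -> V2 * 'I_3) (c : V2 * 'I_3 -> 'I_3 * bool).
Hypotheses (aV : pairing setT a) (cP : good_coloring setT a c).
Variables (B : 'I_3 -> V1 -> bool) (o : V2 * 'I_3 -> bool).
Hypothesis BP : forall m i x, i != m -> B m (across k i x) = ~~ B m x.
Hypothesis oP : forall z, (c z).2 -> o (mate c z) = ~~ o z /\ o (a z) = ~~ o z.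

(* The colour of the edges of G1 at x that are lifted along the dart z; on the
   fibre of x, the orientation o of the mixed cycles and the bipartition B
   decide which of its two colours a mixed dart takes. *)
Definition fibre_color x z : 'I_3 :=
  let m := (c z).1 in
  if (c z).2 then (if B m x (+) o z then ordS m else ordS (ordS m)) else m.

Lemma ordS3 (m : 'I_3) : [/\ ordS m != m, ordS (ordS m) != m & ordS m != ordS (ordS m)].
Proof. by case: m => [[|[|[|//]]] ?]. Qed.

Lemma fibre_color_mixed x z : (c z).2 -> fibre_color x z != (c z).1.
Proof.
by rewrite /fibre_color => ->; have [? ? _] := ordS3 (c z).1; case: ifP.
Qed.

(** Two mixed darts at [y] are mates, so [o] gives them different colours of the pair, and both
    differ from the colour [m] of the pure dart. *)
Lemma fibre_color_inj x y : injective (fun j => fibre_color x (y, j)).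
Proof.
have [_ _ /(_ y (in_setT _)) gy] := cP.
have [H|[i0 [m H]]] := gy => i j E.
  have [ci ij] := H i j; have [cj _] := H j j; apply: ij.
  by move: E; rewrite /fibre_color ci cj.
suff one l l' : l != i0 -> l' != l -> fibre_color x (y, l) = fibre_color x (y, l') -> False.
  apply/eqP; apply: contraT => ij; have [ii|ii] := eqVneq i i0.
    by case: (one j i); rewrite // -ii eq_sym.
  by case: (one i j); rewrite // eq_sym.
move=> li ll; have cl : (c (y, l)).2 by rewrite H.
have [m1 m2 cm us] := mateP (gy : good_at c (y, l).1) cl.
have [Em|nm] := eqVneq (y, l') (mate c (y, l)).
  rewrite Em /fibre_color cm cl; have [-> _] := oP cl; rewrite addbN.
  by have [_ _ /negbTE n] := ordS3 (c (y, l)).1; case: (_ (+) _) => /eqP /=;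
    rewrite ?n // eq_sym n.
have cl' : c (y, l') = ((c (y, l)).1, false) by apply: us; rewrite // xpair_eqE eqxx.
by move=> E'; have := fibre_color_mixed x cl; rewrite E' {1}/fibre_color cl' eqxx.
Qed.

Lemma fibre_color_onto x y i : exists2 z, z.1 = y & fibre_color x z = i.
Proof.
have [j _ <-] := inj_to3_onto (etrans (cardsT _) (card_ord 3)) (in2W (@fibre_color_inj x y)) i.
by exists (y, j).
Qed.

(** The colour taken by a mixed dart differs from [m], so crossing an edge of that colour flips
    [B m], while [a] flips [o]; their exclusive or is unchanged, and the two ends of a lifted edge
    agree. *)
Lemma fibre_color_across x z : fibre_color (across k (fibre_color x z) x) (a z) = fibre_color x z.
Proof.
have [cI _ _] := cP; rewrite {1}/fibre_color cI ?inE //.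
case cz: (c z).2; last by rewrite /fibre_color cz.
rewrite BP ?fibre_color_mixed //; have [_ ->] := oP cz.
by rewrite addNb addbN negbK /fibre_color cz.
Qed.

(** An edge of G1 lifted along a dart [z] sitting over its end [true], with [a z] over the other
    end. Fixing the end makes each lift occur once; the condition at the other end follows by
    [fibre_color_flip]. *)
Definition product_edge : finType :=
  {p : edge G1 * (V2 * 'I_3) | fibre_color (endpoint p.1 true) p.2 == k p.1}.

Definition end_dart (f : product_edge) (b : bool) : V2 * 'I_3 :=
  if b then (val f).2 else a (val f).2.

Definition product : mgraph (V1 * V2)%type :=
  MGraph (fun (f : product_edge) b => (endpoint (val f).1 b, (end_dart f b).1)).

Lemma aK z : a (a z) = z.
Proof. by case: (pairingP aV (in_setT z.1)). Qed.

Lemma fibre_color_flip (e : edge G1) b z :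
  fibre_color (endpoint e b) z = k e -> fibre_color (endpoint e (~~ b)) (a z) = k e.
Proof.
move=> E; rewrite -[RHS]E -(fibre_color_across (endpoint e b) z) E.
by have /= -> := acrossE kP (e, b).
Qed.

Lemma fibre_color_end f b : fibre_color (endpoint (val f).1 b) (end_dart f b) = k (val f).1.
Proof.
case: f b => -[e z] /= /eqP E [] //=; exact: (fibre_color_flip (b := true)).
Qed.

Lemma end_dart_flip f b : end_dart f (~~ b) = a (end_dart f b).
Proof. by case: b; rewrite /end_dart ?aK. Qed.

Lemma product_edge_exists (e : edge G1) b z : fibre_color (endpoint e b) z = k e ->
  exists f : product_edge, (val f).1 = e /\ end_dart f b = z.
Proof.
move=> E; have P : fibre_color (endpoint e true) (if b then z else a z) == k e.
  by apply/eqP; case: b E => // /fibre_color_flip.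
by exists (exist _ (e, if b then z else a z) P); split=> //; case: b {E} P => //= _; rewrite /end_dart /= aK.
Qed.

Lemma product_edge_eq (f f' : product_edge) b :
  (val f).1 = (val f').1 -> end_dart f b = end_dart f' b -> f = f'.
Proof.
move=> E1 E2; have {}E2 : (val f).2 = (val f').2.
  by move: E2; rewrite /end_dart; case: b => // /(congr1 a); rewrite !aK.
by apply: val_inj; case: (val f) (val f') E1 E2 => [? ?] [? ?] /= -> ->.
Qed.

Lemma fibre_color_inj_dart x z z' :
  z.1 = z'.1 -> fibre_color x z = fibre_color x z' -> z = z'.
Proof. by case: z z' => [y j] [y' j'] /= -> /fibre_color_inj ->. Qed.

(** A half-edge of G1 at [x] has exactly one lift at [(x, y)], along the only dart at [y] whose
    fibre colour over [x] is the colour of its edge. *)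
Lemma product_covers1 : covering_map product G1 fst.
Proof.
case=> x y; rewrite /neighbors -map_comp.
pose pr (h : product_edge * bool) := ((val h.1).1, h.2).
rewrite (eq_map (g := (fun h : edge G1 * bool => endpoint h.1 (~~ h.2)) \o pr)) //.
rewrite map_comp; apply: perm_map; apply: uniq_perm; rewrite ?enum_uniq //.
  rewrite map_inj_in_uniq ?enum_uniq // => -[f b] [f' b']; rewrite !mem_enum !inE /=.
  move=> /eqP[Ex Ey] /eqP[Ex' Ey'] [E1 E2]; rewrite -{b'}E2 in Ex' Ey' *; congr (_, _).
  apply: (product_edge_eq (b := b)) => //.
  apply: (@fibre_color_inj_dart x); first by rewrite Ey Ey'.
  by rewrite -{1}Ex -Ex' !fibre_color_end E1.
move=> [e b]; rewrite mem_enum inE /=; apply/mapP/eqP.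
  by case=> -[f b']; rewrite mem_enum inE => /eqP /= [<- _] [-> ->].
move=> ex; have [z zy zk] := fibre_color_onto x y (k e).
have [f [fe fz]] := @product_edge_exists e b z (etrans (congr1 (fibre_color^~ z) ex) zk).
by exists (f, b); rewrite ?mem_enum ?inE /= /pr ?fe ?fz ?ex ?zy.
Qed.

(** Conversely, a dart [w] at [y] carries exactly one half-edge at [(x, y)], the lift of the
    half-edge at [x] of colour [fibre_color x w]. *)
Lemma product_covers2 (G2 : mgraph V2) (deg2 : forall v, degree G2 v <= 3) :
  cubic G2 -> a = dart_pairing G2 -> covering_map product G2 snd.
Proof.
move=> cub2 aE [x y]; rewrite /neighbors -map_comp.
pose pr (h : product_edge * bool) := end_dart h.1 h.2.
rewrite (eq_map (g := (fun z => (a z).1) \o pr)); last first.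
  by case=> f b; rewrite /= end_dart_flip.
rewrite [map _ (enum (halfedges G2 _))](eq_map (g := (fun z => (a z).1) \o @dart _ G2)); last first.
  by move=> h; rewrite /= aE dart_pairingE.
rewrite (map_comp _ pr) (map_comp _ (@dart _ G2)); apply: perm_map; apply: uniq_perm.
- rewrite map_inj_in_uniq ?enum_uniq // => -[f b] [f' b']; rewrite !mem_enum !inE /=.
  move=> /eqP[Ex _] /eqP[Ex' _]; rewrite /pr /= => E.
  have : ((val f).1, b) = ((val f').1, b').
    apply: (kP (v := x)); rewrite ?inE /= ?Ex ?Ex' //.
    by rewrite -(fibre_color_end f b) -(fibre_color_end f' b') Ex Ex' E.
  by case=> E1 E2; rewrite -E2 in E *; rewrite (product_edge_eq E1 E).
- by rewrite map_inj_uniq ?enum_uniq //; apply: dart_inj.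
move=> z; apply/mapP/mapP => [[[f b]]|[h]]; rewrite mem_enum inE /=.
  move=> /eqP[_ zy] ->; rewrite /pr /=.
  have [h hy hz] := inj_to3_onto (cub2 y) (@slot_inj _ _ deg2 y) (end_dart f b).2.
  exists h; rewrite ?mem_enum //; move: hy; rewrite inE /dart hz => /eqP->.
  by rewrite -zy -surjective_pairing.
move=> /eqP hy ->; set w := dart h.
have [[e b] ex kw] := color_at cub1 kP x (fibre_color x w).
move: ex; rewrite inE /= => /eqP ex.
have [f [fe fz]] := @product_edge_exists e b w (etrans (congr1 (fibre_color^~ w) ex) (esym kw)).
by exists (f, b); rewrite ?mem_enum ?inE /= /pr /= ?fe ?fz ?ex /= ?hy.
Qed.

End TightProduct.

Lemma tight_product_exists (V1 V2 : finType) (G1 : mgraph V1) (G2 : mgraph V2) :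
  cubic G1 -> class1 G1 -> cubic G2 ->
  exists H : mgraph (V1 * V2)%type, tight_product G1 G2 H.
Proof.
move=> cub1 [[k kP] _] cub2.
(* Without vertices in G1 the maximum degree is not 3; the product is then the empty graph. *)
have [x0|V1_0] := pickP [pred x : V1 | true]; last first.
  have nV (p : V1 * V2) : False by have := V1_0 p.1.
  by exists (MGraph (fun (e : void) _ => match e with end)); split=> p; case: (nV p).
have D3 : max_degree G1 = 3.
  apply/eqP; rewrite eqn_leq; apply/andP; split.
    by apply/bigmax_leqP => x _; rewrite cub1.
  by rewrite -(cub1 x0); apply: leq_bigmax.
move: k kP; rewrite D3 => k kP.
have deg2 v : degree G2 v <= 3 by rewrite cub2.
have aV := pairing_darts deg2.
have [c cP] := good_coloring_exists aV; have [cI cF cL] := cP.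
have [B BP] := fin_all_exists (bipartition_avoiding cub1 kP).
pose X := [set z | (c z).2].
have sX z : z \in X -> [/\ mate c z \in X, mate c (mate c z) = z & mate c z != z].
  rewrite !inE => cz; have gz : good_at c z.1 by apply: cL; rewrite inE.
  by have [_ ? -> _] := mateP gz cz; rewrite mateK.
have tX z : z \in X -> [/\ dart_pairing G2 z \in X,
    dart_pairing G2 (dart_pairing G2 z) = z & dart_pairing G2 z != z].
  rewrite !inE => cz; have zT : z.1 \in [set: V2] by rewrite inE.
  have [_ ->] := pairingP aV zT; rewrite cI //; split=> //.
  by apply: contraTN cz => /eqP /(cF _ zT) ->.
(* On the mixed darts, [mate] and the pairing trace out the mixed cycles; a 2-colouring that
   alternates along them tells outgoing from incoming darts, which is an orientation. *)
have [o oX] := two_involutions sX tX.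
have oP z : (c z).2 -> o (mate c z) = ~~ o z /\ o (dart_pairing G2 z) = ~~ o z.
  by move=> cz; apply: oX; rewrite inE.
exists (product k (dart_pairing G2) c B o); split.
  exact: product_covers1.
exact: product_covers2.
Qed.

Theorem theorem3 :
  (forall (V : finType) (G : mgraph V),
     max_degree G = 3 ->
     exists c : edge G -> semi_color (max_degree G), semi_coloring c) /\
  (forall (V1 V2 : finType) (G1 : mgraph V1) (G2 : mgraph V2),
     cubic G1 -> class1 G1 -> cubic G2 ->
     exists H : mgraph (V1 * V2)%type, tight_product G1 G2 H).
Proof. by split; [exact: semi_coloring_exists|exact: tight_product_exists]. Qed.
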